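(* Let $A: \mathbb{T}^n \to \mathbb{T}^n$, $n\ge 2$, be a linear Anosov endomorphism with $\dim E^u_A = 1$. Then there is a $C^1$ open set $\mathcal{U}$ (in the space of $C^1$ maps $\mathbb{T}^n\to\mathbb{T}^n$) containing $A$ such that for every $f\in\mathcal{U}$ which is a $C^{1+\alpha}$ conservative Anosov endomorphism for some $\alpha>0$, we have $\lambda^u_f(x)\le \lambda^u(A)$ for $m$-almost every $x\in\mathbb{T}^n$, where $m$ is the Lebesgue measure of $\mathbb{T}^n$.
   Context: An $f$-orbit is a sequence $(x_n)_{n\in\mathbb{Z}}$ with $f(x_n)=x_{n+1}$ for all $n\in\mathbb{Z}$. A $C^1$ local diffeomorphism $f: M\to M$ of a closed manifold is an Anosov endomorphism if there are constants $C>0$ and $\lambda>1$ such that for every $f$-orbit $\tilde x=(x_n)_{n\in\mathbb{Z}}$ there is a splitting $T_{x_i}M = E^s_{x_i}\oplus E^u_{x_i}$, $i\in\mathbb{Z}$, preserved by $Df$, such that for all $n>0$ and all $i\in\mathbb{Z}$: $\|Df^n(x_i)v\|\ge C^{-1}\lambda^n\|v\|$ for every $v\in E^u_{x_i}$, and $\|Df^n(x_i)v\|\le C\lambda^{-n}\|v\|$ for every $v\in E^s_{x_i}$. Write $E^u(\tilde x)\subset T_{x_0}M$ for the unstable subspace at $x_0$ given by the orbit $\tilde x$; it may depend on $\tilde x$ and not only on $x_0$. A linear Anosov endomorphism of $\mathbb{T}^n=\mathbb{R}^n/\mathbb{Z}^n$ is a map induced by an integer matrix $A$ with nonzero determinant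 and no eigenvalue of modulus $1$; $E^u_A$ is its unstable subspace in $\mathbb{R}^n$, and, when $\dim E^u_A=1$, $\lambda^u(A)=\log|\mu|$, where $\mu$ is the eigenvalue of $A$ on $E^u_A$. Conservative means that $f$ preserves the Lebesgue measure $m$. The neighbourhood $\mathcal U$ can be taken small enough that the unstable directions of $f$ are also one-dimensional. In this one-dimensional setting the unstable Lyapunov exponent of $f$ at $x$ is $\lambda^u_f(x)=\lim_{k\to+\infty}\frac1k\log\|Df^k(x)|_{E^u(\tilde x)}\|$, where $\tilde x$ is an $f$-orbit with $x_0=x$; by the Multiplicative Ergodic Theorem for endomorphisms, for $m$-almost every $x$ this limit exists and does not depend on the choice of the orbit $\tilde x$ through $x$ (i.e. on the choice of unstable direction at $x$). *)

(* Defs.v *)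
From HB Require Import structures.
From mathcomp Require Import all_boot all_order all_algebra.
From mathcomp Require Import generic_quotient.
From mathcomp Require Import complex.
From mathcomp Require Import all_classical all_reals all_analysis.

Set Implicit Arguments.
Unset Strict Implicit.
Unset Printing Implicit Defensive.

Import Order.TTheory GRing.Theory Num.Theory.
Import numFieldNormedType.Exports.

Local Open Scope classical_set_scope.
Local Open Scope quotient_scope.
Local Open Scope ring_scope.

(* Vectors of R^n are row vectors; matrices act on the right (v |-> v *m M) and
   a linear subspace of R^n is the row space of a square matrix, as in
   mxalgebra and in [jacobian]. *)

Definition torus_rel (R : realType) (n : nat) (x y : 'rV[R]_n) : bool :=
  [forall i, (x 0 i - y 0 i) \is a Num.int].

Lemma torus_rel_refl (R : realType) (n : nat) : reflexive (@torus_rel R n).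
Proof. by move=> x; apply/forallP => i; rewrite subrr rpred0. Qed.

Lemma torus_rel_sym (R : realType) (n : nat) : symmetric (@torus_rel R n).
Proof. by move=> x y; apply: eq_forallb => i; rewrite -rpredN opprB. Qed.

Lemma torus_rel_trans (R : realType) (n : nat) : transitive (@torus_rel R n).
Proof.
move=> y x z /forallP xy /forallP yz; apply/forallP => i.
by rewrite -(subrKA (y 0 i)) rpredD.
Qed.

Definition torus_equiv (R : realType) (n : nat) : equiv_rel 'rV[R]_n :=
  EquivRel (@torus_rel R n) (@torus_rel_refl R n) (@torus_rel_sym R n)
    (@torus_rel_trans R n).

Definition torus (R : realType) (n : nat) : Type := {eq_quot (torus_equiv R n)}.

HB.instance Definition _ (R : realType) (n : nat) :=
  EqQuotient.copy (torus R n) {eq_quot (torus_equiv R n)}.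
HB.instance Definition _ (R : realType) (n : nat) :=
  Choice.copy (torus R n) {eq_quot (torus_equiv R n)}.

Definition proj (R : realType) (n : nat) (x : 'rV[R]_n) : torus R n :=
  \pi_(torus R n) x.

HB.instance Definition _ (R : realType) (n : nat) :=
  isPointed.Build (torus R n) (proj 0).

Definition tuple_proj (R : realType) (n : nat)
    (t : n.-tuple (measurableTypeR R)) : torus R n :=
  proj (\row_(i < n) (tnth t i : R)).

(* The Borel sigma-algebra of the torus: B is measurable iff its preimage in
   R^n is. *)
Definition torus_measurable (R : realType) (n : nat) : set (set (torus R n)) :=
  image_set_system setT (@tuple_proj R n) measurable.

Lemma torus_measurable_sigma (R : realType) (n : nat) :
  sigma_algebra setT (@torus_measurable R n).
Proof. exact/sigma_algebra_image/sigma_algebra_measurable. Qed.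

Lemma torus_measurable0 (R : realType) (n : nat) :
  @torus_measurable R n set0.
Proof. by case: (@torus_measurable_sigma R n). Qed.

Lemma torus_measurableC (R : realType) (n : nat) (B : set (torus R n)) :
  torus_measurable B -> torus_measurable (~` B).
Proof.
by case: (@torus_measurable_sigma R n) => _ mC _ /mC; rewrite setTD.
Qed.

Lemma torus_measurable_bigcup (R : realType) (n : nat)
    (B : (set (torus R n))^nat) :
  (forall i, torus_measurable (B i)) -> torus_measurable (\bigcup_i B i).
Proof. by case: (@torus_measurable_sigma R n) => _ _; exact. Qed.

Definition torus_display : measure_display.
Proof. exact: default_measure_display. Qed.

HB.instance Definition _ (R : realType) (n : nat) :=
  @isMeasurable.Build torus_display (torus R n) (@torus_measurable R n)
    (@torus_measurable0 R n) (@torus_measurableC R n)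
    (@torus_measurable_bigcup R n).

Lemma measurable_tuple_proj (R : realType) (n : nat) :
  measurable_fun [set: n.-tuple (measurableTypeR R)] (@tuple_proj R n).
Proof. by move=> _ B mB. Qed.

HB.instance Definition _ (R : realType) (n : nat) :=
  isMeasurableFun.Build _ _ _ _ (@tuple_proj R n)
    (@measurable_tuple_proj R n).

Definition cons_pair (R : realType) (n : nat)
    (tx : measurableTypeR R * n.-tuple (measurableTypeR R)) :
    n.+1.-tuple (measurableTypeR R) :=
  [the n.+1.-tuple _ of tx.1 :: tx.2].

Lemma measurable_cons_pair (R : realType) (n : nat) :
  measurable_fun setT (@cons_pair R n).
Proof. exact: measurable_cons. Qed.

HB.instance Definition _ (R : realType) (n : nat) :=
  isMeasurableFun.Build _ _ _ _ (@cons_pair R n) (@measurable_cons_pair R n).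

(* Lebesgue measure on the unit cube [0, 1]^n, as an n-fold product. *)
Fixpoint cube_measure (R : realType) (n : nat) :
    probability (n.-tuple (measurableTypeR R)) R :=
  match n with
  | 0%N => \d_([tuple])
  | n'.+1 => distribution
      (uniform_prob (@ltr01 R) \x cube_measure R n')%E (@cons_pair R n')
  end.

Definition torus_measure (R : realType) (n : nat) :
    probability (torus R n) R :=
  distribution (cube_measure R n) (@tuple_proj R n).

Definition enorm (R : realType) (n : nat) (v : 'rV[R]_n) : R :=
  Num.sqrt (\sum_(i < n) v 0 i ^+ 2).

Definition torus_ball (R : realType) (n : nat) (e : R) (p q : torus R n) :
    Prop :=
  exists x y : 'rV[R]_n, [/\ proj x = p, proj y = q & enorm (x - y) < e].

Definition C1_on (R : realType) (n : nat) (O : set 'rV[R]_n)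
    (F : 'rV[R]_n -> 'rV[R]_n) : Prop :=
  forall x, O x -> differentiable F x /\ {for x, continuous (jacobian F)}.

(* Maps of the torus are C^1 when they have a C^1 lift: since R^n is simply
   connected, every continuous torus map lifts, and the projection is a local
   diffeomorphism. *)
Definition C1_lift (R : realType) (n : nat) (f : torus R n -> torus R n) :
    set ('rV[R]_n -> 'rV[R]_n) :=
  [set F | (forall x, proj (F x) = f (proj x)) /\ C1_on setT F].

Definition C1_map (R : realType) (n : nat) (f : torus R n -> torus R n) : Prop :=
  C1_lift f !=set0.

Definition lift_of (R : realType) (n : nat) (f : torus R n -> torus R n) :
    'rV[R]_n -> 'rV[R]_n :=
  xget (fun x : 'rV[R]_n => x) (C1_lift f).

(* The matrix of Df(p) in the trivialisation T(T^n) = T^n x R^n.  Two C^1 lifts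
   differ by a constant integer vector, and the derivative of a lift is
   Z^n-periodic, so neither the lift nor the representative of p matters.  The
   value is meaningful only when f is C^1. *)
Definition tderiv (R : realType) (n : nat) (f : torus R n -> torus R n)
    (p : torus R n) : 'M[R]_n :=
  jacobian (lift_of f) (repr p).

Definition C1_alpha (R : realType) (n : nat) (alpha : R)
    (f : torus R n -> torus R n) : Prop :=
  C1_map f /\
  exists K : R, forall x y : 'rV[R]_n,
    `|tderiv f (proj x) - tderiv f (proj y)| <= K * enorm (x - y) `^ alpha.

Definition C1_close (R : realType) (n : nat) (e : R)
    (f g : torus R n -> torus R n) : Prop :=
  forall p, torus_ball e (f p) (g p) /\ `|tderiv f p - tderiv g p| < e.

(* U is open in the space of C^1 maps.  Bounding f - g and Df - Dg pointwise by
   e instead of bounding their suprema gives the same C^1 topology. *)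
Definition C1_open (R : realType) (n : nat)
    (U : set (torus R n -> torus R n)) : Prop :=
  forall f, U f -> C1_map f /\
    exists2 e : R, 0 < e & forall g, C1_map g -> C1_close e f g -> U g.

(* Stated on a lift: the projection R^n -> T^n is itself a local diffeomorphism. *)
Definition local_diffeo (R : realType) (n : nat)
    (f : torus R n -> torus R n) : Prop :=
  C1_map f /\
  forall x, exists V : set 'rV[R]_n, exists G : 'rV[R]_n -> 'rV[R]_n,
    [/\ open V, V x, open (lift_of f @` V),
        (forall y, V y -> G (lift_of f y) = y) &
        C1_on (lift_of f @` V) G].

Definition is_orbit (R : realType) (n : nat) (f : torus R n -> torus R n)
    (x : int -> torus R n) : Prop :=
  forall i, f (x i) = x (i + 1).

Definition hyperbolic_splitting (R : realType) (n : nat)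
    (f : torus R n -> torus R n) (C lambda : R) (x : int -> torus R n)
    (Es Eu : int -> 'M[R]_n) : Prop :=
  [/\ forall i, (Es i + Eu i :=: 1%:M)%MS /\ (Es i :&: Eu i)%MS = 0,
      forall i, (Es i *m tderiv f (x i) :=: Es (i + 1)%R)%MS /\
                (Eu i *m tderiv f (x i) :=: Eu (i + 1)%R)%MS,
      forall (i : int) (k : nat) (v : 'rV[R]_n), (0 < k)%N -> (v <= Eu i)%MS ->
        C^-1 * lambda ^+ k * enorm v <=
          enorm (v *m tderiv (iter k f) (x i)) &
      forall (i : int) (k : nat) (v : 'rV[R]_n), (0 < k)%N -> (v <= Es i)%MS ->
        enorm (v *m tderiv (iter k f) (x i)) <=
          C * lambda ^- k * enorm v].

Definition anosov (R : realType) (n : nat) (f : torus R n -> torus R n) : Prop :=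
  local_diffeo f /\
  exists C lambda : R, [/\ 0 < C, 1 < lambda &
    forall x, is_orbit f x ->
      exists Es Eu : int -> 'M[R]_n, hyperbolic_splitting f C lambda x Es Eu].

(* E is the subspace E^u(x) of the tangent space at x_0.  It is unique: its
   vectors are those whose backward iterates along the orbit x decay. *)
Definition is_unstable_subspace (R : realType) (n : nat)
    (f : torus R n -> torus R n) (x : int -> torus R n) (E : 'M[R]_n) : Prop :=
  exists C lambda : R, exists Es Eu : int -> 'M[R]_n,
    [/\ 0 < C, 1 < lambda, hyperbolic_splitting f C lambda x Es Eu &
        (E :=: Eu 0)%MS].

Definition restr_norm (R : realType) (n : nat) (M E : 'M[R]_n) : R :=
  sup [set enorm (v *m M) | v in [set v | (v <= E)%MS /\ enorm v = 1]].

(* The limit exists and equals l for every choice of an orbit x through p, that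
   is, of an unstable direction at p. *)
Definition is_unstable_exponent (R : realType) (n : nat)
    (f : torus R n -> torus R n) (p : torus R n) (l : R) : Prop :=
  forall (x : int -> torus R n) (E : 'M[R]_n),
    is_orbit f x -> x 0 = p -> is_unstable_subspace f x E ->
    (fun k : nat => k%:R^-1 * ln (restr_norm (tderiv (iter k f) p) E))
      @ \oo --> l.

Definition conservative (R : realType) (n : nat)
    (f : torus R n -> torus R n) : Prop :=
  forall B : set (torus R n), measurable B ->
    torus_measure R n (f @^-1` B) = torus_measure R n B.

Definition torus_linear (R : realType) (n : nat) (A : 'M[int]_n)
    (p : torus R n) : torus R n :=
  proj (repr p *m map_mx intr A).

Definition complex_mx (R : realType) (n : nat) (A : 'M[int]_n) : 'M[R[i]]_n :=
  map_mx intr A.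

Definition linear_anosov (R : realType) (n : nat) (A : 'M[int]_n) : Prop :=
  \det A != 0 /\
  forall z : R[i], eigenvalue (complex_mx R A) z -> `|z| != 1.

Definition eigenvalues (R : realType) (n : nat) (A : 'M[int]_n) : seq R[i] :=
  sval (closed_field_poly_normal (char_poly (complex_mx R A))).

(* E is the real subspace E^u_A: its complexification is the sum of the
   generalised eigenspaces of A for the eigenvalues of modulus > 1. *)
Definition is_linear_unstable_subspace (R : realType) (n : nat)
    (A : 'M[int]_n) (E : 'M[R]_n) : Prop :=
  (map_mx (real_complex R) E :=:
     \sum_(z <- eigenvalues R A | (1 < `|z|)%R) geigenspace (complex_mx R A) z)%MS.

(* Main.v *)
(* Let e span E^u_A and let pi be the A-equivariant linear form with pi e = 1,
   so pi (v A) = mu pi v.  If f is C^1-close to A, a cone around e is mapped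
   into a narrower one by every Df, and f lifts to F with F(x + k) = F x + k A
   for integer k.  Put b_k = |pi (e Df^k)|.

   Upper bound.  On the cone pi has constant sign, so the integral of b_k over
   the torus is, up to sign, that of the derivative of pi F^k in the direction
   e; writing it in coordinates and integrating along each coordinate circle,
   it only depends on pi F^k(x + k) - pi F^k(x), hence equals |mu|^k.  By
   Markov's inequality b_k grows almost everywhere at rate at most |mu|.

   Existence.  Two vectors of the narrow cone are expanded by comparable
   factors, so ln b_k is additive along orbits up to a bounded error, and the
   argument of Katznelson and Weiss for the ergodic theorem gives the almost
   everywhere convergence of (ln b_k) / k; this is where f is conservative.

   Every unstable subspace of f lies in the narrow cone, because its vectors
   have decaying backward iterates while those outside the cone do not; so its
   expansion is comparable to b_k as well, for every choice of the orbit. *)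

Require Import Defs.
From mathcomp Require Import all_boot all_order all_algebra.
From mathcomp Require Import complex.
From mathcomp Require Import all_classical all_reals all_analysis.
From mathcomp Require Import measurable_realfun ring lra zify.

Set Implicit Arguments.
Unset Strict Implicit.
Unset Printing Implicit Defensive.

Import Order.TTheory GRing.Theory Num.Theory.
Import numFieldNormedType.Exports.

Local Open Scope classical_set_scope.
Local Open Scope ring_scope.

(* [mathcomp_extra.proj] shadows the projection onto the torus. *)
Local Notation proj := Defs.proj.

(** * Matrix-valued maps and jacobians *)

(** The exponent is required along every orbit through p at once, and these may be uncountably many.
    Comparing all of them with [b_k], which depends on p alone and is continuous on the lift, leaves
    a single null set and a measurable sequence. The form pi comes from a polynomial in A: if the
    characteristic polynomial is Q times a power of X - mu with Q(mu) nonzero, then Q(A) has rank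
    one, its rows are multiples of e, and its column factor, rescaled, is pi. Cones must be
    preserved by single steps, because Df varies from point to point, but A need not contract the
    kernel of pi in one step for the given norm. Hence a seminorm T that vanishes at e and is
    contracted by A at once; the cone is T v <= |pi v|. One radius [d0] governs the neighbourhood:
    it is at most 1/2, so that F(x + k) - F(x) - k A, which is integral and small, vanishes; and it
    is small against both |mu| - 1 and 1 - theta, so that the error Df - A spoils neither the
    expansion of pi nor the contraction of T. *)

Lemma le_mx_norm_entry (R : realType) (m n : nat) (M : 'M[R]_(m, n)) i j :
  `|M i j| <= `|M|.
Proof.
rewrite [leRHS]mx_normrE.
exact: (le_bigmax _ (fun k : 'I_m * 'I_n => `|M k.1 k.2|) (i, j)).
Qed.

Lemma continuous_mxP (R : realType) (V : topologicalType) (m n : nat)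
    (M : V -> 'M[R]_(m, n)) (x : V) :
  (forall i j, {for x, continuous (fun y => M y i j)}) -> {for x, continuous M}.
Proof.
move=> Mc; apply/(@cvgrPdist_le _ 'M[R]_(m, n)) => e e0; near=> y.
rewrite /Num.Def.normr/= mx_normrE (bigmax_le _ (ltW e0))//= => i _.
rewrite !mxE; move: i; near: y; apply: filter_forall => /= i.
by have /cvgrPdist_le := Mc i.1 i.2; apply.
Unshelve. all: by end_near. Qed.

Lemma continuous_entry (R : realType) (V : topologicalType) (m n : nat)
    (M : V -> 'M[R]_(m, n)) (x : V) i j :
  {for x, continuous M} -> {for x, continuous (fun y => M y i j)}.
Proof.
move=> Mc; apply: (@continuous_comp _ _ _ M (fun N : 'M[R]_(m, n) => N i j)) => //.
exact: coord_continuous.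
Qed.

Lemma continuous_mulmx (R : realType) (V : topologicalType) (m n p : nat)
    (M : V -> 'M[R]_(m, n)) (N : V -> 'M[R]_(n, p)) (x : V) :
  {for x, continuous M} -> {for x, continuous N} ->
  {for x, continuous (fun y => M y *m N y)}.
Proof.
move=> Mc Nc; apply: continuous_mxP => i j.
have -> : (fun y => (M y *m N y) i j) = \sum_k (fun y => M y i k * N y k j).
  by apply/funext => y; rewrite mxE fct_sumE.
elim/big_rec: _ => [|k g _ gc]; first exact: cvg_cst.
by apply: cvgD => //; apply: cvgM; apply: continuous_entry.
Qed.

Lemma mulmx_ext (R : realType) (n m : nat) (M N : 'M[R]_(n, m)) :
  (forall v : 'rV[R]_n, v *m M = v *m N) -> M = N.
Proof.
move=> H; rewrite -[M]mul1mx -[N]mul1mx; apply/row_matrixP => i.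
by rewrite !row_mul H.
Qed.

Lemma mulmx_jacobian (R : realType) (n m : nat) (F : 'rV[R]_n -> 'rV[R]_m) x v :
  differentiable F x -> v *m jacobian F x = 'D_v F x.
Proof. by move=> dF; exact/esym/(deriveEjacobian v dF). Qed.

(** A jacobian depends only on increments. Two points for one lift give periodicity; two lifts at
    one point give independence of the lift. *)
Lemma jacobian_eqP (R : realType) (n m : nat) (F G : 'rV[R]_n -> 'rV[R]_m) x y :
  differentiable F x -> differentiable G y ->
  (forall h, F (h + x) - F x = G (h + y) - G y) -> jacobian F x = jacobian G y.
Proof.
move=> dF dG FG; apply: mulmx_ext => v.
transitivity ('D_v F x); first exact: mulmx_jacobian.
transitivity ('D_v G y); last exact/esym/mulmx_jacobian.
rewrite /derive.
suff -> : (fun h : R => h^-1 *: ((F \o shift x) (h *: v) - F x)) =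
  (fun h : R => h^-1 *: ((G \o shift y) (h *: v) - G y)) by [].
by apply/funext => h /=; rewrite FG.
Qed.

Lemma jacobian_comp (R : realType) (n : nat) (F G : 'rV[R]_n -> 'rV[R]_n) x :
  differentiable F x -> differentiable G (F x) ->
  jacobian (G \o F) x = jacobian F x *m jacobian G (F x).
Proof.
move=> dF dG; have dGF := differentiable_comp dF dG.
apply: mulmx_ext => v; rewrite mulmxA.
transitivity ('D_v (G \o F) x); first exact: mulmx_jacobian.
transitivity ('D_('D_v F x) G (F x)); last first.
  rewrite -(mulmx_jacobian _ dG); congr (_ *m _).
  exact/esym/mulmx_jacobian.
transitivity ('d (G \o F) x v); first exact: deriveE.
transitivity ('d G (F x) ('d F x v)); first exact: (congr1 (@^~ v) (diff_comp dF dG)).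
transitivity ('d G (F x) ('D_v F x)); first by congr ('d G (F x) _); exact/esym/deriveE.
exact/esym/deriveE.
Qed.

Lemma differentiable_mulmxr (R : realType) (m n p : nat) (A : 'M[R]_(n, p))
    (x : 'M[R]_(m, n)) : differentiable (mulmxr A) x.
Proof.
apply: linear_differentiable => y.
by apply: (@continuous_mulmx R _ m n p id (fun=> A) y);
  [exact: (@cvg_id _ (nbhs y))|exact: cst_continuous].
Qed.

Lemma jacobian_mulmxr (R : realType) (n p : nat) (A : 'M[R]_(n, p)) x :
  jacobian (mulmxr A : 'rV[R]_n -> 'rV[R]_p) x = A.
Proof.
have dA : differentiable (mulmxr A : 'rV[R]_n -> 'rV[R]_p) x.
  exact: differentiable_mulmxr.
apply: mulmx_ext => v; transitivity ('D_v (mulmxr A : 'rV[R]_n -> 'rV[R]_p) x).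
  exact: mulmx_jacobian.
transitivity ('d (mulmxr A : 'rV[R]_n -> 'rV[R]_p) x v); first exact: deriveE.
have cA : continuous (mulmxr A : 'rV[R]_n -> 'rV[R]_p).
  by move=> y; apply: differentiable_continuous; exact: differentiable_mulmxr.
exact: (congr1 (@^~ v) (diff_lin x cA)).
Qed.

(* On a segment h would have to pass through an integer plus one half. *)
Lemma near_int_bounded (R : realType) (n : nat) (h : 'rV[R]_n -> R) (d : R) :
  d <= 2^-1 -> continuous h ->
  (forall x, exists2 z : R, z \is a Num.int & `|h x - z| < d) ->
  forall x y, `|h x - h y| < 2 * d.
Proof.
move=> d2 hc hz.
have lt_step (x y : 'rV[R]_n) (z w : R) : z \is a Num.int -> w \is a Num.int ->
    `|h x - z| < d -> `|h y - w| < d -> ~ z < w.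
  move=> /intrP[k ->] /intrP[l ->] xk yl; rewrite ltr_int => kl.
  have kl1 : k%:~R + 1 <= l%:~R :> R by rewrite -(intrD _ k 1) ler_int lezD1.
  pose s (t : R) := h (x + t *: (y - x)).
  have sc : {within `[0, 1], continuous s}.
    apply: continuous_subspaceT => t; apply: continuous_comp; last exact: hc.
    apply: cvgD; first exact: cvg_cst.
    by apply: cvgZl; exact: cvg_id.
  have s0 : s 0 = h x by rewrite /s scale0r addr0.
  have s1 : s 1 = h y by rewrite /s scale1r addrC subrK.
  have xk' : h x < k%:~R + 2^-1 by move: xk; rewrite ltr_norml => /andP[]; lra.
  have yl' : k%:~R + 2^-1 < h y by move: yl; rewrite ltr_norml => /andP[]; lra.
  have [|t _ st] := @IVT R s 0 1 (k%:~R + 2^-1) ler01 sc.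
    by rewrite s0 s1 ge_min le_max (ltW xk') (ltW yl') orbT.
  have [_ /intrP[m ->]] := hz (x + t *: (y - x)); rewrite -/(s t) st => tm.
  have {}tm : `|k%:~R + 2^-1 - m%:~R| < 2^-1 :> R by exact: lt_le_trans tm _.
  have [km|mk] := ltP k m.
    have : k%:~R + 1 <= m%:~R :> R by rewrite -(intrD _ k 1) ler_int lezD1.
    by move: tm; rewrite ltr_norml => /andP[]; lra.
  have : m%:~R <= k%:~R :> R by rewrite ler_int.
  by move: tm; rewrite ltr_norml => /andP[]; lra.
move=> x y; have [z zint xz] := hz x; have [w wint yw] := hz y.
have zw : z = w.
  apply/eqP; rewrite eq_le !real_leNgt ?Num.Theory.num_real//; apply/andP; split; apply/negP.
    exact: lt_step yw xz.
  exact: lt_step xz yw.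
move: xz yw; rewrite zw !ltr_norml => /andP[? ?] /andP[? ?].
by apply/andP; split; lra.
Qed.

(** Case d = 1/2 of the previous bound: the difference of two values is an integer of modulus less
    than 1. *)
Lemma int_valued_const (R : realType) (n : nat) (h : 'rV[R]_n -> R) :
  continuous h -> (forall x, h x \is a Num.int) -> forall x y, h x = h y.
Proof.
move=> hc hint x y.
have : `|h x - h y| < 2 * 2^-1.
  by apply: near_int_bounded => // z; exists (h z); rewrite ?subrr ?normr0 ?invr_gt0.
rewrite divff// => hlt; apply/eqP; rewrite -subr_eq0.
have : h x - h y \is a Num.int by rewrite rpredB.
move: hlt => /[swap] /intrP[k ->].
by rewrite -intr_norm (ltr_int _ _ 1) intr_eq0; lia.
Qed.

(** * Almost everywhere convergence of near-additive sequences *)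

Section orbit_blocks.
Variables (R : realType) (T : Type) (f : T -> T) (c : nat -> T -> R) (K : R).
Hypotheses (K_ge0 : 0 <= K) (c0 : forall x, - K <= c 0 x)
  (c1 : forall x, - K <= c 1 x)
  (cD : forall k l x, c k x + c l (iter k f x) - K <= c (k + l)%N x).

(** Splitting off one step costs [K] for the cut and at most [K] for [c 1]. *)
Lemma superadditive_ge k x : - (2 * K) * k%:R - K <= c k x.
Proof.
elim: k x => [|k IH] x; first by rewrite mulr0 sub0r.
have := cD 1 k x; have := IH (iter 1 f x); have := c1 x.
by rewrite add1n -natr1; lra.
Qed.

(* An orbit segment is cut into blocks along which c is nonnegative and single
   visits to B; each cut costs at most K, which eps times the length of a block
   pays for. *)
Lemma block_decomposition (D B : set T) (eps : R) (M : nat) :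
  0 <= eps -> (forall x, D x -> D (f x)) ->
  (forall x, D x -> ~ B x -> exists k,
     [/\ (0 < k)%N, (k <= M)%N, K <= eps * k%:R & 0 <= c k x]) ->
  forall L x, D x ->
  - (eps * L%:R) - 2 * K * (\sum_(0 <= j < L) \1_B (iter j f x))
    - (2 * K * M%:R + K) <= c L x.
Proof.
move=> eps0 Df HB.
have Dit k x : D x -> D (iter k f x) by move=> Dx; elim: k => //= k; apply: Df.
have S_ge0 L x : 0 <= \sum_(0 <= j < L) (\1_B (iter j f x) : R).
  by apply: sumr_ge0 => j _; rewrite indicE.
elim/ltn_ind => L IH x Dx.
(* A last segment of length at most [M] is not decomposed; it accounts for the constant 2 K M +
   K. *)
have [LM|ML] := leqP L M.
  have := superadditive_ge L x.
  have : 2 * K * L%:R <= 2 * K * M%:R by rewrite ler_wpM2l ?ler_nat ?mulr_ge0.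
  have : 0 <= eps * L%:R by rewrite mulr_ge0.
  have : 0 <= 2 * K * (\sum_(0 <= j < L) \1_B (iter j f x)).
    by rewrite !mulr_ge0.
  lra.
have split k : (k <= L)%N -> \sum_(0 <= j < L) (\1_B (iter j f x) : R) =
    \sum_(0 <= j < k) (\1_B (iter j f x) : R) +
    \sum_(0 <= j < L - k) (\1_B (iter j f (iter k f x)) : R).
  move=> kL; rewrite (big_cat_nat (n := k))//=; congr (_ + _).
  rewrite -{1}(add0n k) big_addn; apply: eq_bigr => j _.
  by rewrite iterD.
(* A visit to [B] is a block of length 1: the cut and [c 1] cost at most [K] each. Off [B] only the
   cut costs, and [eps] times the block length pays for it. *)
have [Bx|nBx] := pselect (B x).
  have L0 : (1 <= L)%N by apply: leq_ltn_trans ML.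
  have := IH (L - 1)%N ltac:(lia) (f x) (Df _ Dx).
  have := cD 1%N (L - 1)%N x; rewrite subnKC// (split 1 L0) big_nat1/= indicE mem_set//=.
  have := c1 x; rewrite natrB//.
  have : 0 <= eps * 1 by rewrite mulr1.
  move: (\sum_(_ <= _ < _) _) => S; rewrite ?mulr1n; lra.
have [k [k0 kM Kk ck]] := HB x Dx nBx.
have kL : (k <= L)%N by apply: leq_trans kM (ltnW ML).
have := IH (L - k)%N ltac:(lia) (iter k f x) (Dit k x Dx).
have := cD k (L - k)%N x; rewrite subnKC// (split k kL) natrB//.
have : 0 <= 2 * K * (\sum_(0 <= j < k) \1_B (iter j f x)).
  by rewrite !mulr_ge0.
move: (\sum_(_ <= _ < L - k) _) => S; lra.
Qed.

End orbit_blocks.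

(** The limit is the upper limit, obtained as the supremum of [S]. Rational a < b chosen just below
    it exclude the first alternative, and the second keeps [u] above a. Rational bounds make the
    exceptional sets countable in number. *)
Lemma cvgn_no_oscillation (R : realType) (u : nat -> R) (M : R) :
  (forall k, `|u k| <= M) ->
  (forall a b : rat, a < b ->
     (exists N, forall k, (N <= k)%N -> u k < ratr b) \/
     (exists N, forall k, (N <= k)%N -> ratr a < u k)) ->
  cvgn u.
Proof.
move=> uM H.
pose S := [set y | forall N, exists2 k, (N <= k)%N & y <= u k].
have uP k : - M <= u k /\ u k <= M by apply/andP; rewrite -ler_norml.
have S_M : S (- M) by move=> N; exists N => //; case: (uP N).
have supS : has_sup S.
  split; first by exists (- M).
  by exists M => y /(_ 0%N)[k _ /le_trans]; apply; case: (uP k).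
apply/cvg_ex; exists (sup S); apply/cvgrPdist_lt => e e0.
have [N1 HN1] : exists N, forall k, (N <= k)%N -> u k < sup S + e.
  apply: contrapT => HN; suff : S (sup S + e).
    by move=> /(ub_le_sup supS.2); lra.
  move=> N; apply: contrapT => HN'; apply: HN; exists N => k Nk.
  by rewrite ltNge; apply/negP => le_u; apply: HN'; exists k.
have [a] := @rat_in_itvoo R (sup S - e) (sup S - e / 2) ltac:(lra).
rewrite in_itv/= => /andP[a1 a2].
have [b] := @rat_in_itvoo R (sup S - e / 2) (sup S) ltac:(lra).
rewrite in_itv/= => /andP[b1 b2].
have ab : a < b by rewrite -(ltr_rat R); lra.
have [y Sy yb] : exists2 y, S y & ratr b < y by apply: sup_gt b2; exists (- M).
have [[N2 HN2]|[N2 HN2]] := H a b ab.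
  by have [k /HN2 uk] := Sy N2; lra.
near=> k.
have k1 : u k < sup S + e by apply: HN1; near: k; exact: nbhs_infty_ge.
have k2 : ratr a < u k by apply: HN2; near: k; exact: nbhs_infty_ge.
rewrite ltr_norml; apply/andP; split; lra.
Unshelve. all: by end_near. Qed.

(** Moving the base point along the orbit changes [c] by a bounded amount and the index by j; both
    are absorbed by (b - b') k once k is large. *)
Lemma often_shift (R : realType) (T : Type) (f : T -> T) (c : nat -> T -> R) (K b b' : R)
    (j : nat) (x : T) : 0 <= K ->
  (forall k l x, `|c (k + l)%N x - c k x - c l (iter k f x)| <= K) -> b' < b ->
  (forall N, exists2 k : nat, (N <= k)%N & b * k%:R <= c k x) ->
  forall N, exists2 k : nat, (N <= k)%N & b' * k%:R <= c k (iter j f x).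
Proof.
move=> K_ge0 cD bb' H N.
have [m mP] := H (N + j + Num.bound ((`|c j x| + K + `|b' * j%:R|) / (b - b'))%R)%N.
have Kj : (`|c j x| + K + `|b' * j%:R|) <= (b - b') * m%:R.
  rewrite [leRHS]mulrC -ler_pdivrMr ?subr_gt0//.
  have C0 : 0 <= (`|c j x| + K + `|b' * j%:R|) / (b - b').
    by apply: divr_ge0; [rewrite !addr_ge0|rewrite subr_ge0 ltW].
  rewrite (le_trans (ltW (archi_boundP C0)))//.
  by rewrite ler_nat (leq_trans _ mP)// leq_addl.
move=> bm; exists (m - j)%N; first by move: mP; lia.
have jm : (j <= m)%N by move: mP; lia.
have /ler_normlP[] := cD j (m - j)%N x; rewrite subnKC// natrB//.
have := ler_norm (c j x); have := ler_norm (- (b' * j%:R)); rewrite normrN.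
lra.
Qed.

(** * Visits, oscillation and convergence for a probability-preserving map *)

Section preserved_probability.
Context d (T : measurableType d) (R : realType) (P : probability T R).
Variable f : T -> T.
Hypotheses (mf : measurable_fun setT f)
  (Pf : forall B, measurable B -> P (f @^-1` B) = P B).

Lemma measurable_iter k : measurable_fun setT (iter k f).
Proof.
elim: k => [|k IH]; first exact: measurable_id.
exact: (measurableT_comp mf IH).
Qed.

Lemma measurable_preimage_iter k B :
  measurable B -> measurable (iter k f @^-1` B).
Proof. by move=> mB; rewrite -[_ @^-1` _]setTI; apply: measurable_iter. Qed.

Lemma probability_preimage_iter k B :
  measurable B -> P (iter k f @^-1` B) = P B.
Proof.
move=> mB; elim: k => [//|k IH].
rewrite -IH -(Pf (measurable_preimage_iter k mB)); congr (P _).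
by apply/seteqP; split => x /=; rewrite -iterSr.
Qed.

(* Integrate the number of visits to B over D. *)
Lemma measure_le_visits (D B : set T) (eta : R) (L : nat) :
  measurable D -> measurable B -> 0 <= eta -> (0 < L)%N ->
  (forall x, D x ->
     eta * L%:R <= \sum_(0 <= j < L) (\1_B (iter j f x) : R)) ->
  (eta%:E * P D <= P B)%E.
Proof.
move=> mD mB eta0 L0 H.
have mI j : measurable_fun setT (EFin \o (fun x => \1_B (iter j f x) : R)).
  apply/measurable_EFinP.
  exact: (measurableT_comp (measurable_indic mB) (measurable_iter j)).
have mID : measurable_fun setT (EFin \o (\1_D : T -> R)).
  by apply/measurable_EFinP; exact: measurable_indic.
have IB j : (\int[P]_x (\1_B (iter j f x) : R)%:E = P B)%E.
  rewrite (_ : (fun x => _) = fun x => (\1_(iter j f @^-1` B) x : R)%:E); last first.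
    by apply/funext => x; rewrite !indicE; congr (_%:R%:E); apply/idP/idP; rewrite !inE.
  rewrite integral_indic ?setIT//; last exact: measurable_preimage_iter.
  exact: probability_preimage_iter.
have ID : (\int[P]_x (\1_D x : R)%:E = P D)%E.
  by rewrite integral_indic// setIT.
have le_int : (\int[P]_x ((eta * L%:R)%:E * (\1_D x)%:E) <=
        \int[P]_x \sum_(0 <= j < L) (\1_B (iter j f x) : R)%:E)%E.
  apply: ge0_le_integral => //.
  - by move=> x _; rewrite mule_ge0// lee_fin ?mulr_ge0// indicE.
  - exact: measurable_funeM.
  - exact: emeasurable_sum.
  - move=> x _; rewrite sumEFin -EFinM lee_fin [in leLHS]indicE.
    have [Dx|nDx] := pselect (D x).
      by rewrite (mem_set Dx) mulr1 H.
    rewrite memNset// mulr0 sumr_ge0// => j _; by rewrite indicE.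
have EL : (\int[P]_x ((eta * L%:R)%:E * (\1_D x)%:E) =
    L%:R%:E * (eta%:E * P D))%E.
  by rewrite ge0_integralZl_EFin ?mulr_ge0 ?ID 1?mulrC ?EFinM ?muleA.
have ER : (\int[P]_x \sum_(0 <= j < L) (\1_B (iter j f x) : R)%:E =
    L%:R%:E * P B)%E.
  rewrite ge0_integral_sum//; under eq_bigr do rewrite IB.
  by rewrite sumr_const_nat subn0 mule_natl.
by move: le_int; rewrite EL ER lee_pmul2l// lte_fin ltr0n.
Qed.

Variables (c : nat -> T -> R) (K : R).
Hypotheses (mc : forall k, measurable_fun setT (c k))
  (cD : forall k l x, `|c (k + l)%N x - c k x - c l (iter k f x)| <= K)
  (c1 : forall x, `|c 1 x| <= K).

Let often_ge (b : R) (A : set nat) : set T :=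
  \bigcup_(k in A) [set x | b * k%:R <= c k x].
Let often_le (a : R) (A : set nat) : set T :=
  \bigcup_(k in A) [set x | c k x <= a * k%:R].

Let measurable_often_ge b A : measurable (often_ge b A).
Proof.
apply: bigcup_measurable => k _.
rewrite (_ : mkset _ = c k @^-1` `[b * k%:R, +oo[); last first.
  by apply/seteqP; split => x /=; rewrite in_itv/= andbT.
by rewrite -[_ @^-1` _]setTI; apply: mc => //; exact: measurable_itv.
Qed.

Let measurable_often_le a A : measurable (often_le a A).
Proof.
apply: bigcup_measurable => k _.
rewrite (_ : mkset _ = c k @^-1` `]-oo, a * k%:R]).
  by rewrite -[_ @^-1` _]setTI; apply: mc => //; exact: measurable_itv.
by apply/seteqP; split => x /=; rewrite in_itv/=.
Qed.

(** Quantifying over all iterates j builds in the forward invariance that the block decomposition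
    asks of [D]. *)
Let oscillation (a b : R) : set T :=
  \bigcap_j \bigcap_N iter j f @^-1`
    (often_ge b [set k | (N <= k)%N] `&` often_le a [set k | (N <= k)%N]).

Let measurable_oscillation a b : measurable (oscillation a b).
Proof.
apply: bigcap_measurable => // j _; apply: bigcap_measurable => // N _.
by apply: measurable_preimage_iter; apply: measurableI.
Qed.

Let K_ge0 : 0 <= K.
Proof. exact: le_trans (c1 point). Qed.

Let oscillation_iterf a b x : oscillation a b x -> oscillation a b (f x).
Proof. by move=> Dx j _ N _; have := Dx j.+1 I N I; rewrite /= -iterSr. Qed.

(* On the oscillation set the block decompositions of c - b and of a - c add up
   to a positive proportion of visits to B M, whose measure tends to 0. *)
Lemma oscillation_null a b : a < b -> P (oscillation a b) = 0%E.
Proof.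
move=> ab; set D := oscillation a b.
have mD : measurable D by exact: measurable_oscillation.
(* The terms |a| and |b| let both c_k - b k and a k - c_k satisfy the hypotheses of the block
   decomposition; the 1 makes [K'] positive. *)
have [K' K'E] : exists K', K' = K + `|a| + `|b| + 1 by exists (K + `|a| + `|b| + 1).
have [c0K' c1K' cDK'] : [/\ forall y, - K' <= c 0 y - b * 0%:R /\ - K' <= a * 0%:R - c 0 y,
    forall y, - K' <= c 1 y - b * 1%:R /\ - K' <= a * 1%:R - c 1 y &
    forall k l y, c k y + c l (iter k f y) - K' <= c (k + l)%N y /\
      c (k + l)%N y <= c k y + c l (iter k f y) + K'].
  have norm_bound t : `|t| <= K -> - K <= t /\ t <= K.
    by move=> H; apply/andP; rewrite -ler_norml.
  have c0 y : - K <= c 0 y /\ c 0 y <= K.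
    by have /norm_bound := cD 0 0 y; rewrite /= addn0; lra.
  have a_le := ler_norm a; have b_le := ler_norm b.
  have := ler_norm (- a); have := ler_norm (- b); rewrite !normrN => b_ge a_ge.
  rewrite K'E; split.
  - by move=> y; have := c0 y; lra.
  - by move=> y; have := norm_bound _ (c1 y); lra.
  - by move=> k l y; have := norm_bound _ (cD k l y); lra.
have K'0 : 0 < K' by rewrite K'E; have := K_ge0; have := normr_ge0 a; have := normr_ge0 b; lra.
(* Adding the two decompositions over length L gives 4 K' S >= (b - a) L - 2 eps L - 2 C for the
   number S of visits. A quarter of the gap leaves 2 eps L, of which half absorbs 2 C when L is
   large: S >= eps L / (4 K'). *)
have [eps epsE] : exists eps, b = a + 4%:R * eps.
  by exists ((b - a) / 4%:R); field.
have eps0 : 0 < eps by lra.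
have [k0 k0P] : exists k0 : nat, (0 < k0)%N /\ K' <= eps * k0%:R.
  exists (Num.bound (K' / eps)).+1; split => //.
  rewrite mulrC -ler_pdivrMr// ltW// (lt_le_trans (archi_boundP _))//.
    by rewrite divr_ge0// ltW.
  by rewrite ler_nat.
pose I M : set nat := [set k | (k0 <= k <= M)%N].
(* The points of [D] that lack a block of one of the two kinds with length between [k0] and [M].
   They decrease to the empty set, since on [D] both kinds occur at arbitrarily large lengths. *)
pose B M := D `\` (often_ge b (I M) `&` often_le a (I M)).
have mB M : measurable (B M).
  by apply: measurableD; [exact: measurable_oscillation|exact: measurableI].
have capB : \bigcap_M B M = set0.
  apply/seteqP; split => // x Bx; have Dx : D x by case: (Bx 0%N Logic.I).
  have [[k /= kk0 bk] [l /= lk0 al]] := Dx 0%N Logic.I k0 Logic.I.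
  have [_] := Bx (maxn k l) Logic.I; apply; split.
    by exists k => //=; rewrite /I/= kk0 leq_maxl.
  by exists l => //=; rewrite /I/= lk0 leq_maxr.
have cvgB : P \o B @ \oo --> 0%E.
  rewrite -(measure0 P) -capB; apply: nonincreasing_cvg_mu => //.
  - by rewrite (le_lt_trans (probability_le1 P (mB 0%N)))// ltry.
  - by rewrite capB.
  - apply/nonincreasing_seqP => n; apply/subsetPset => x [Dx H]; split => //.
    case=> -[k /= /andP[k1 k2] bk] [l /= /andP[l1 l2] al]; apply: H; split.
      by exists k => //=; rewrite /I/= k1 (leq_trans k2).
    by exists l => //=; rewrite /I/= l1 (leq_trans l2).
have key M : ((eps / (4%:R * K'))%:E * P D <= P (B M))%E.
  pose C := 2 * K' * M%:R + K'.
  have [L [L0 LC]] : exists L : nat, (0 < L)%N /\ 2 * C <= eps * L%:R.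
    have C0 : 0 <= 2 * C / eps.
      by rewrite divr_ge0// ?mulr_ge0// ?addr_ge0 ?mulr_ge0// ltW.
    exists (Num.bound (2 * C / eps)).+1; split => //.
    rewrite [leRHS]mulrC -ler_pdivrMr// (le_trans (ltW (archi_boundP C0)))//.
    by rewrite ler_nat.
  have nB y : D y -> ~ B M y -> (often_ge b (I M) `&` often_le a (I M)) y.
    by move=> Dy nBy; apply: contrapT => H; apply: nBy.
  have le_epsk k : (k0 <= k)%N -> K' <= eps * k%:R.
    by move=> k1; apply: le_trans (k0P.2) _; rewrite ler_wpM2l ?ler_nat// ltW.
  pose S x : R := \sum_(0 <= j < L) \1_(B M) (iter j f x).
  have ge_b x : D x -> - (eps * L%:R) - 2 * K' * S x - C <= c L x - b * L%:R.
    apply: (@block_decomposition R T f (fun k x => c k x - b * k%:R)).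
    - exact: ltW.
    - by move=> y; case: (c0K' y).
    - by move=> y; case: (c1K' y).
    - by move=> k l y; case: (cDK' k l y); rewrite natrD; lra.
    - exact: ltW.
    - exact: oscillation_iterf.
    - move=> y Dy /(nB _ Dy)[[k /= /andP[k1 k2] bk] _].
      by exists k; split => //; [lia|exact: le_epsk|rewrite subr_ge0].
  have le_a x : D x -> - (eps * L%:R) - 2 * K' * S x - C <= a * L%:R - c L x.
    apply: (@block_decomposition R T f (fun k x => a * k%:R - c k x)).
    - exact: ltW.
    - by move=> y; case: (c0K' y).
    - by move=> y; case: (c1K' y).
    - by move=> k l y; case: (cDK' k l y); rewrite natrD; lra.
    - exact: ltW.
    - exact: oscillation_iterf.
    - move=> y Dy /(nB _ Dy)[_ [k /= /andP[k1 k2] ak]].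
      by exists k; split => //; [lia|exact: le_epsk|rewrite subr_ge0].
  have eta_ge0 : 0 <= eps / (4%:R * K').
    by apply: divr_ge0; [exact: ltW|rewrite mulr_ge0// ltW].
  apply: (measure_le_visits mD (mB M) eta_ge0 L0) => x Dx.
  have := ge_b x Dx; have := le_a x Dx; rewrite -/(S x).
  rewrite epsE => H1 H2.
  by rewrite mulrAC ler_pdivrMr ?mulr_gt0//; lra.
have : ((eps / (4%:R * K'))%:E * P D <= 0)%E.
  by apply: (cvge_ge _ cvgB); apply: nearW => M; exact: key.
rewrite pmule_rle0 ?lte_fin ?divr_gt0 ?mulr_gt0// => PD.
by apply/eqP; rewrite eq_le PD measure_ge0.
Qed.

Lemma near_additive_bound k x : `|c k x| <= 2 * K * k%:R + K.
Proof.
have norm_bound t : `|t| <= K -> - K <= t /\ t <= K.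
  by move=> H; apply/andP; rewrite -ler_norml.
have c0 y : - K <= c 0 y /\ c 0 y <= K.
  by have /norm_bound := cD 0 0 y; rewrite /= addn0; lra.
have c1' y := norm_bound _ (c1 y).
have cD' l m y := norm_bound _ (cD l m y).
have := @superadditive_ge R T f c K (fun y => (c0 y).1) (fun y => (c1' y).1)
  ltac:(by move=> l m y; have := cD' l m y; lra) k x.
have := @superadditive_ge R T f (fun l y => - c l y) K
  ltac:(by move=> y; have := c0 y; lra) ltac:(by move=> y; have := c1' y; lra)
  ltac:(by move=> l m y; have := cD' l m y; lra) k x.
by move=> H1 H2; rewrite ler_norml; apply/andP; split; lra.
Qed.

(** A bounded sequence that diverges oscillates across some rational interval, and there are
    countably many of these; [pickle] enumerates them. *)
Theorem near_additive_cvg :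
  {ae P, forall x, cvgn (fun k => k%:R^-1 * c k x)}.
Proof.
pose F n := if unpickle n is Some (a, b) then
  if a < b :> rat then oscillation (ratr a) (ratr b) else set0 else set0.
have F0 n : P.-negligible (F n).
  rewrite /F; case: unpickle => [[a b]|]; last exact: negligible_set0.
  case: ifPn => ab; last exact: negligible_set0.
  apply/negligibleP; first exact: measurable_oscillation.
  by apply: oscillation_null; rewrite ltr_rat.
apply: negligibleS (negligible_bigcup F0) => x /= ncvg.
apply: contrapT => nF; apply: ncvg.
have nosc (a b : rat) : a < b -> ~ oscillation (ratr a) (ratr b) x.
  move=> ab H; apply: nF; exists (pickle (a, b)); first exact: I.
  by rewrite /F pickleK ab.
apply: (@cvgn_no_oscillation R _ (3%:R * K)).
  (* At k = 0 the inverse is 0 by convention; for k > 0 the bound is 2 K + K / k <= 3 K. *)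
  case=> [|k]; first by rewrite invr0 mul0r normr0 mulr_ge0.
  rewrite normrM ger0_norm ?invr_ge0// mulrC ler_pdivrMr ?ltr0n//.
  apply: le_trans (near_additive_bound _ _) _.
  have : K * 1 <= K * k.+1%:R by rewrite ler_wpM2l ?ler1n.
  lra.
move=> a b ab; apply: contrapT => /not_orP[Ha Hb].
(* Passing to iterates of x loses a little at each end, so the interval is shrunk on both sides. *)
have [b' /andP[ab' b'b]] : exists b', a < b' < b by exists ((a + b) / 2); rewrite !midf_lt.
have [a' /andP[aa' a'b']] : exists a', a < a' < b' by exists ((a + b') / 2); rewrite !midf_lt.
have Nc k l y : `|- c (k + l)%N y - - c k y - - c l (iter k f y)| <= K.
  by rewrite -opprD -opprD normrN.
apply: (nosc a' b' a'b') => j _ N _; split.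
- have [] := @often_shift R T f c K (ratr b) (ratr b') j x _ _ _ _ N;
    rewrite ?ltr_rat//.
    (* The successor keeps k positive, so that dividing by k is legitimate. *)
    move=> N'; apply: contrapT => HN; apply: Ha; exists N'.+1 => k Nk.
    rewrite ltNge; apply/negP => le_u; apply: HN; exists k; first exact: ltnW.
    by rewrite -ler_pdivlMr ?ltr0n ?(leq_trans _ Nk)// mulrC.
  by move=> k Nk bk; exists k.
- have [] := @often_shift R T f (fun k y => - c k y) K (- ratr a) (- ratr a') j x
    _ _ _ _ N; rewrite ?ltrN2 ?ltr_rat//.
    move=> N'; apply: contrapT => HN; apply: Hb; exists N'.+1 => k Nk.
    rewrite ltNge; apply/negP => le_u; apply: HN; exists k; first exact: ltnW.
    by rewrite mulNr lerN2 -ler_pdivrMr ?ltr0n ?(leq_trans _ Nk)// mulrC.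
  by move=> k Nk; rewrite mulNr lerN2 => ak; exists k.
Qed.

End preserved_probability.

(** * The hyperbolic splitting of the linear map *)

Lemma horner_mx_eigen (F : comNzRingType) (n : nat) (A : 'M[F]_n.+1)
    (v : 'rV[F]_n.+1) (a : F) (p : {poly F}) :
  v *m A = a *: v -> v *m horner_mx A p = p.[a] *: v.
Proof.
move=> vA; elim/poly_ind: p => [|p c IH].
  by rewrite rmorph0 mulmx0 horner0 scale0r.
rewrite rmorphD rmorphM /= horner_mx_X horner_mx_C mulmxDr -[_ * A]/(_ *m A).
by rewrite mulmxA IH -scalemxAl vA mul_mx_scalar !hornerE scalerDl scalerA.
Qed.

Lemma kermxpoly_dvd (F : fieldType) (n : nat) (A : 'M[F]_n.+1)
    (p q : {poly F}) :
  p %| q -> (kermxpoly A p <= kermxpoly A q)%MS.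
Proof.
move=> /dvdpP[r ->]; rewrite mulrC; apply/sub_kermxP.
rewrite rmorphM /= -[_ * _]/(_ *m _) mulmxA.
by have /sub_kermxP-> := submx_refl (kermxpoly A p); rewrite mul0mx.
Qed.

Lemma contraction_cvg0 (R : realType) (q : R) (a b : nat -> R) :
  0 <= q < 1 -> (forall k, 0 <= a k) -> (forall k, a k.+1 <= q * a k + b k) ->
  b @ \oo --> (0 : R) -> a @ \oo --> (0 : R).
Proof.
move=> /andP[q0 q1] a0 ab b0; apply/cvgrPdist_lt => e e0.
(* With [b] below this value, the fixed point of the recursion is e / 2. *)
have e1 : 0 < e * (1 - q) / 2 by rewrite divr_gt0 ?mulr_gt0// subr_gt0.
have /cvgrPdist_lt/(_ _ e1)[N _ HN] := b0.
have aN j : a (N + j)%N <= q ^+ j * a N + e / 2.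
  elim: j => [|j IH]; first by rewrite addn0 expr0 mul1r lerDl divr_ge0// ltW.
  rewrite addnS; apply: le_trans (ab _) _.
  have := HN (N + j)%N (leq_addr _ _); rewrite sub0r normrN => /(le_lt_trans (ler_norm _)).
  have := ler_wpM2l q0 IH; rewrite exprS; lra.
have : (fun j => q ^+ j * a N) @ \oo --> (0 : R).
  rewrite -(mul0r (a N)); apply: cvgMl; apply: cvg_expr.
  by rewrite ger0_norm.
have e2 : 0 < e / 2 by rewrite divr_gt0.
move=> /cvgrPdist_lt/(_ _ e2)[M _ HM]; exists (N + M)%N => // k /= NMk.
have MkN : (M <= k - N)%N by rewrite leq_subRL ?(leq_trans _ NMk) ?leq_addr.
have := HM _ MkN; rewrite !sub0r !normrN => /(le_lt_trans (ler_norm _)).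
have := aN (k - N)%N; rewrite subnKC ?(leq_trans _ NMk) ?leq_addr//.
rewrite ger0_norm//; lra.
Qed.

(** A norm with values in [R], where the limits are taken; the modulus on [R[i]] has values in
    [R[i]]. *)
Definition l1c (R : realType) (n : nat) (v : 'rV[R[i]]_n) : R :=
  \sum_j Normc.normc (v 0 j).

Lemma normc_ge0 (R : realType) (z : R[i]) : 0 <= Normc.normc z.
Proof. by case: z => x y; exact: sqrtr_ge0. Qed.

Lemma l1c_ge0 (R : realType) (n : nat) (v : 'rV[R[i]]_n) : 0 <= l1c v.
Proof. by apply: sumr_ge0 => j _; exact: normc_ge0. Qed.

Lemma l1cZD (R : realType) (n : nat) (z : R[i]) (u v : 'rV[R[i]]_n) :
  l1c (z *: u + v) <= Normc.normc z * l1c u + l1c v.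
Proof.
rewrite mulr_sumr -big_split /=; apply: ler_sum => j _; rewrite !mxE.
by rewrite (le_trans (le_normcD _ _))// Normc.normcM.
Qed.

Lemma normc_real (R : realType) (x : R) : Normc.normc (x%:C)%C = `|x|.
Proof. by rewrite /Normc.normc /= expr0n addr0 sqrtr_sqr. Qed.

Lemma ltc1_real (R : realType) (x : R) : (1 < `|(x%:C)%C|) = (1 < `|x|).
Proof. by rewrite normc_def /= expr0n addr0 sqrtr_sqr -[1]/(1%:C)%C ltcR. Qed.

Lemma le_mxnorm_l1c (R : realType) (n : nat) (v : 'rV[R]_n) :
  `|v| <= l1c (map_mx (real_complex R) v).
Proof.
rewrite [leLHS]mx_normrE; apply/bigmax_leP; split; first exact: l1c_ge0.
move=> [i j] _ /=; rewrite ord1 /l1c (bigD1 j)//= mxE normc_real lerDl.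
by apply: sumr_ge0 => k _; exact: normc_ge0.
Qed.

(* v A^(k+1) = z v A^k + u A^k with u = v (A - z), which is killed by the
   remaining factors. *)
Lemma decay_of_annihilator (R : realType) (n : nat) (A : 'M[R[i]]_n.+1)
    (rs : seq R[i]) (v : 'rV[R[i]]_n.+1) :
  (forall z, z \in rs -> `|z| < 1) ->
  v *m horner_mx A (\prod_(z <- rs) ('X - z%:P)) = 0 ->
  (fun k => l1c (v *m A ^+ k)) @ \oo --> (0 : R).
Proof.
elim: rs v => [|z rs IH] v Hrs.
  rewrite big_nil rmorph1 mulmx1 => ->.
  rewrite (_ : (fun k => _) = fun=> 0); first exact: cvg_cst.
  apply/funext => k; rewrite mul0mx /l1c big1// => j _.
  by rewrite mxE Normc.normc0.
rewrite big_cons rmorphM /= rmorphB /= horner_mx_X horner_mx_C.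
rewrite -[_ * horner_mx _ _]/(_ *m _) mulmxA => vA.
have z1 : Normc.normc z < 1.
  have := Hrs z (mem_head _ _); rewrite normc_def /Normc.normc.
  by case: z {Hrs vA} => x y /=; rewrite ltcR.
apply: (@contraction_cvg0 R (Normc.normc z) _
    (fun k => l1c (v *m (A - z%:M) *m A ^+ k))).
- by rewrite normc_ge0 z1.
- by move=> k; exact: l1c_ge0.
- move=> k; rewrite (_ : v *m A ^+ k.+1 = z *: (v *m A ^+ k) +
      v *m (A - z%:M) *m A ^+ k); first exact: l1cZD.
  rewrite exprS -[_ * _]/(_ *m _) mulmxA mulmxBr mulmxBl mul_mx_scalar.
  by rewrite -scalemxAl addrC subrK.
- by apply: IH => // w wrs; apply: Hrs; rewrite inE wrs orbT.
Qed.

Section unstable_direction.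
Variables (R : realType) (n : nat) (A : 'M[int]_n.+1).
Hypothesis hA : linear_anosov R A.
Variable Eu : 'M[R]_n.+1.
Hypotheses (hEu : is_linear_unstable_subspace A Eu) (dimEu : \rank Eu = 1%N).
Variable mu : R.
Let AR : 'M[R]_n.+1 := map_mx intr A.
Hypothesis hmu : Eu *m AR = mu *: Eu.
Let AC : 'M[R[i]]_n.+1 := complex_mx R A.
Let toC := real_complex R.

Let map_AR : map_mx toC AR = AC.
Proof.
by apply/matrixP => i j; rewrite !mxE; exact: rmorph_int.
Qed.

Let unstable_vector : exists e : 'rV[R]_n.+1, [/\ e != 0, (Eu :=: e)%MS & e *m AR = mu *: e].
Proof.
have /rowV0Pn[v vEu v0] : Eu != 0 by rewrite -mxrank_eq0 dimEu.
exists v; split => //.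
  apply/eqmx_sym/eqmxP; rewrite -(geq_leqif (mxrank_leqif_eq vEu)).
  by rewrite dimEu lt0n mxrank_eq0.
have /submxP[D ->] := vEu.
by rewrite -mulmxA hmu scalemxAr.
Qed.

Let eigenvaluesP z : eigenvalue AC z = (z \in eigenvalues R A).
Proof.
rewrite eigenvalue_root_char /eigenvalues; case: closed_field_poly_normal => rs /= Hrs.
by rewrite Hrs (monicP (char_poly_monic _)) scale1r root_prod_XsubC.
Qed.

Let geigenspace_unstable z : eigenvalue AC z -> 1 < `|z| ->
  (geigenspace AC z <= map_mx toC Eu)%MS.
Proof.
rewrite eigenvaluesP => zrs z1; rewrite hEu.
by rewrite (big_rem z)//= z1 addsmxSl.
Qed.

(** Gives |mu| > 1: evaluated at the eigenvector e, membership in this kernel makes mu a root of the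
    product. The exponent is the one in [geigenspace]. *)
Let unstable_annihilator :
  (map_mx toC Eu <= kermxpoly AC
    (\prod_(z <- eigenvalues R A | (1 < `|z|)%R) ('X - z%:P) ^+ n.+1))%MS.
Proof.
rewrite hEu; elim: (eigenvalues R A) => [|z rs IH]; first by rewrite !big_nil sub0mx.
rewrite !big_cons; case: ifP => _; last exact: IH.
rewrite addsmx_sub; apply/andP; split.
  by apply: kermxpoly_dvd; exact: dvdp_mulIl.
by apply: submx_trans IH _; apply: kermxpoly_dvd; exact: dvdp_mulIr.
Qed.

(** Write the characteristic polynomial as Q (X - mu)^m with Q(mu) nonzero. By Cayley-Hamilton the
    rows of Q(A) lie in the generalised eigenspace of mu, hence in the line of e, so Q(A) = D e for
    a column D; then c = D / Q(mu). A vector killed by c is killed by Q(A), and all roots of Q have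
    modulus < 1, whence the decay. *)
Lemma hyperbolic_data : exists (e : 'rV[R]_n.+1) (c : 'cV[R]_n.+1),
  [/\ e *m AR = mu *: e, e *m c = 1%:M, AR *m c = mu *: c, 1 < `|mu| &
    forall w : 'rV[R]_n.+1, w *m c = 0 -> (fun k => `|w *m AR ^+ k|) @ \oo --> (0 : R)].
Proof.
have [e [e0 Eue eA]] := unstable_vector.
have eC : map_mx toC e *m AC = toC mu *: map_mx toC e.
  by rewrite -map_AR -map_mxM eA map_mxZ.
have eC0 : map_mx toC e != 0 by rewrite map_mx_eq0.
have EueC : (map_mx toC Eu :=: map_mx toC e)%MS.
  by apply/eqmxP; rewrite !map_submx !Eue submx_refl.
have mu1 : 1 < `|mu|.
  have : (map_mx toC e <= kermxpoly AC
    (\prod_(z <- eigenvalues R A | (1 < `|z|)%R) ('X - z%:P) ^+ n.+1))%MS.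
    by rewrite -EueC.
  move=> /sub_kermxP; rewrite (horner_mx_eigen _ eC) => /eqP.
  rewrite scaler_eq0 (negPf eC0) orbF horner_prod prodf_seq_eq0 => /hasP[z _].
  rewrite horner_exp expf_eq0 !hornerE subr_eq0 => /andP[z1 /= /eqP zmu].
  by move: z1; rewrite -zmu ltc1_real => /andP[].
have mu_eig : eigenvalue AC (toC mu).
  by apply/eigenvalueP; exists (map_mx toC e); [exact: eC|exact: eC0].
have normmu : 1 < `|toC mu| by rewrite ltc1_real.
have chi0 : char_poly AR != 0 by rewrite monic_neq0// char_poly_monic.
have [m [Q]] := multiplicity_XsubC (char_poly AR) mu; rewrite chi0 /= => Qmu chiE.
have m_le : (m <= n.+1)%N.
  have : size (char_poly AR) = n.+2 by rewrite size_char_poly.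
  have Q0 : Q != 0 by apply: contraNneq Qmu => ->; rewrite root0.
  rewrite chiE size_Mmonic ?monic_exp ?monicXsubC// size_exp_XsubC.
  have : (0 < size Q)%N by rewrite size_poly_gt0.
  lia.
(* A root of modulus > 1 has an eigenvector in the complexified line [Eu], so it equals mu, which is
   not a root of Q; modulus 1 is excluded by hyperbolicity. *)
have stable z : root (map_poly toC Q) z -> `|z| < 1.
  move=> Qz.
  have z_eig : eigenvalue AC z.
    rewrite eigenvalue_root_char -map_AR -map_char_poly chiE rmorphM /= rootM.
    by rewrite Qz.
  rewrite lt_neqAle (hA.2 _ z_eig)/= real_leNgt ?normr_real ?real1//.
  apply/negP => z1.
  have /eigenvalueP[v vA v0] := z_eig.
  have : (v <= map_mx toC e)%MS.
    rewrite -EueC; apply: submx_trans (geigenspace_unstable z_eig z1).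
    by apply: submx_trans (eigenspace_sub_geigen _ _); apply/eigenspaceP.
  move=> /submxP[D vD]; move: vA; rewrite vD -mulmxA eC -scalemxAr -vD.
  move/eqP; rewrite -subr_eq0 -scalerBl scaler_eq0 (negPf v0) orbF subr_eq0.
  move=> /eqP muz; move: Qz; rewrite -muz /root horner_map fmorph_eq0.
  by rewrite -/(root Q mu) (negPf Qmu).
have QA : (horner_mx AR Q <= e)%MS.
  rewrite -(map_submx toC) -EueC.
  apply: submx_trans (geigenspace_unstable mu_eig normmu).
  have -> : geigenspace AC (toC mu) = map_mx toC (geigenspace AR mu).
    by rewrite map_geigenspace map_AR.
  rewrite map_submx /geigenspace.
  apply: (submx_trans _ (kermxpoly_dvd AR (dvdp_exp2l ('X - mu%:P) m_le))).
  apply/sub_kermxP; rewrite -[_ *m _]/(_ * _) -rmorphM /= -chiE.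
  exact: Cayley_Hamilton.
have /submxP[D QD] := QA.
have eD : e *m D = Q.[mu]%:M.
  have := horner_mx_eigen Q eA; rewrite QD mulmxA.
  rewrite [e *m D]mx11_scalar mul_scalar_mx => /eqP.
  rewrite -subr_eq0 -scalerBl scaler_eq0 (negPf e0) orbF subr_eq0 => /eqP->.
  by [].
(* Q(A) commutes with A, and e, having full row rank, can be cancelled on the right. *)
have AD : AR *m D = mu *: D.
  have comm : horner_mx AR Q *m AR = AR *m horner_mx AR Q.
    by apply: comm_horner_mx.
  move: comm; rewrite QD -mulmxA eA -scalemxAr mulmxA => /eqP.
  rewrite scalemxAl -subr_eq0 -mulmxBl => /eqP H.
  apply/eqP; rewrite -subr_eq0 -oppr_eq0 opprB.
  have /row_freeP[e' ee'] : row_free e.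
    by rewrite /row_free eqn_leq rank_leq_row lt0n mxrank_eq0.
  by rewrite -[X in X == _]mulmx1 -ee' mulmxA H mul0mx.
have Qmu0 : Q.[mu] != 0 by exact: Qmu.
exists e, (Q.[mu]^-1 *: D); split => //.
- by rewrite -scalemxAr eD scale_scalar_mx mulVf.
- by rewrite -scalemxAr AD !scalerA mulrC.
move=> w /eqP; rewrite -scalemxAr scaler_eq0 invr_eq0 (negPf Qmu0) /= => /eqP wD.
have wQ : map_mx toC w *m horner_mx AC (map_poly toC Q) = 0.
  by rewrite -map_AR -map_horner_mx -map_mxM QD mulmxA wD mul0mx map_mx0.
have [rs QE] := closed_field_poly_normal (map_poly toC Q).
have Q0 : lead_coef (map_poly toC Q) != 0.
  rewrite lead_coef_eq0 map_poly_eq0; apply: contraNneq Qmu => ->.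
  by rewrite root0.
have rsP z : z \in rs -> `|z| < 1.
  move=> zrs; apply: stable; rewrite QE /root hornerZ mulf_eq0 (negPf Q0) /=.
  by rewrite -/(root _ _) root_prod_XsubC.
have annih : map_mx toC w *m horner_mx AC (\prod_(z <- rs) ('X - z%:P)) = 0.
  move: wQ; rewrite QE linearZ /= -scalemxAr => /eqP.
  by rewrite scaler_eq0 (negPf Q0) => /eqP.
have := decay_of_annihilator rsP annih.
apply: squeeze_cvgr; last exact: cvg_cst.
apply: nearW => k; rewrite normr_ge0 /=.
apply: le_trans (le_mxnorm_l1c _) _.
by rewrite map_mxM rmorphXn /= map_AR.
Qed.
End unstable_direction.

(** * Cones *)

Lemma expr_unbounded (R : realType) (x B : R) : 1 < x ->
  exists2 k : nat, (0 < k)%N & B < x ^+ k.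
Proof.
move=> x1; have x0 : 0 < x by rewrite (lt_trans _ x1).
have B0 : 0 < (`|B| + 1)^-1 by rewrite invr_gt0 ltr_wpDl.
have : (fun k => x^-1 ^+ k) @ \oo --> (0 : R).
  by apply: cvg_expr; rewrite gtr0_norm ?invr_gt0// invf_lt1.
move=> /cvgrPdist_lt/(_ _ B0)[N _ HN]; exists N.+1 => //.
have := HN N.+1 (leqnSn N); rewrite sub0r normrN exprVn gtr0_norm ?invr_gt0 ?exprn_gt0//.
rewrite ltf_pV2 ?posrE ?exprn_gt0 ?ltr_wpDl// => H.
by have := ler_norm B; lra.
Qed.

(** * Comparison of the Euclidean norm with the maximum norm *)

Lemma enorm_ge0 (R : realType) (n : nat) (v : 'rV[R]_n) : 0 <= enorm v.
Proof. exact: sqrtr_ge0. Qed.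

Lemma enormZ (R : realType) (n : nat) (a : R) (v : 'rV[R]_n) :
  enorm (a *: v) = `|a| * enorm v.
Proof.
rewrite /enorm -sqrtr_sqr -sqrtrM ?sqr_ge0// mulr_sumr; congr Num.sqrt.
by apply: eq_bigr => i _; rewrite mxE exprMn.
Qed.

Lemma mx_norm_le_enorm (R : realType) (n : nat) (v : 'rV[R]_n) :
  `|v| <= enorm v.
Proof.
rewrite [leLHS]mx_normrE; apply/bigmax_leP; split; first exact: enorm_ge0.
move=> [i j] _ /=; rewrite ord1 -sqrtr_sqr ler_wsqrtr// (bigD1 j)//= lerDl.
by apply: sumr_ge0 => k _; exact: sqr_ge0.
Qed.

Lemma enorm_le_mx_norm (R : realType) (n : nat) (v : 'rV[R]_n) :
  enorm v <= n%:R * `|v|.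
Proof.
rewrite -[leRHS]ger0_norm ?mulr_ge0// -sqrtr_sqr ler_wsqrtr//.
apply: (@le_trans _ _ (\sum_(i < n) `|v| ^+ 2)).
  apply: ler_sum => i _; rewrite -[v 0 i ^+ 2]real_normK ?num_real//.
  by rewrite lerXn2r ?nnegrE// le_mx_norm_entry.
rewrite sumr_const card_ord exprMn -[leLHS]mulr_natl ler_wpM2r ?sqr_ge0//.
by rewrite -natrX ler_nat; case: n {v} => // n; rewrite expnS expn1 leq_pmulr.
Qed.

Lemma mx_norm_mul (R : realType) (m n p : nat) (A : 'M[R]_(m, n))
    (B : 'M[R]_(n, p)) : `|A *m B| <= n%:R * `|A| * `|B|.
Proof.
rewrite [leLHS]mx_normrE; apply/bigmax_leP; split.
  by rewrite !mulr_ge0.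
move=> [i j] _ /=; rewrite mxE (le_trans (ler_norm_sum _ _ _))//.
rewrite -mulrA (_ : _ * _ = \sum_(k < n) (`|A| * `|B|)); last first.
  by rewrite sumr_const card_ord mulr_natl.
by apply: ler_sum => k _; rewrite normrM ler_pM// le_mx_norm_entry.
Qed.

Section adapted_seminorm.
Variables (R : realType) (n : nat) (A : 'M[R]_n.+1) (e : 'rV[R]_n.+1)
  (c : 'cV[R]_n.+1) (mu : R).
Hypotheses (eA : e *m A = mu *: e) (ec : e *m c = 1%:M)
  (Ac : A *m c = mu *: c)
  (decay : forall w : 'rV[R]_n.+1, w *m c = 0 ->
     (fun k => `|w *m A ^+ k|) @ \oo --> (0 : R)).

(** The projection onto the kernel of pi along e. *)
Let P : 'M[R]_n.+1 := 1%:M - c *m e.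

Let Pc : P *m c = 0.
Proof. by rewrite mulmxBl mul1mx -mulmxA ec mulmx1 subrr. Qed.

Let eP : e *m P = 0.
Proof. by rewrite mulmxBr mulmx1 mulmxA ec mul1mx subrr. Qed.

Let PA : P *m A = A *m P.
Proof.
rewrite mulmxBl mulmxBr mul1mx mulmx1 -mulmxA eA mulmxA Ac.
by rewrite -scalemxAr -scalemxAl.
Qed.

Let PP : P *m P = P.
Proof. by rewrite {2}/P mulmxBr mulmx1 mulmxA Pc mul0mx subr0. Qed.

Let vP (v : 'rV[R]_n.+1) : v = v *m P + (v *m c) 0 0 *: e.
Proof.
have E : v *m c *m e = (v *m c) 0 0 *: e.
  by rewrite {1}[v *m c]mx11_scalar mul_scalar_mx.
by rewrite mulmxBr mulmx1 mulmxA E subrK.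
Qed.

(** Decay of the finitely many rows of [P] is uniform. The bound on each row divides by the
    dimension, which [mx_norm_mul] puts back. *)
Let uniform_decay : exists2 N : nat, (0 < N)%N &
  forall v : 'rV[R]_n.+1, `|v *m P *m A ^+ N| <= 2^-1 * `|v *m P|.
Proof.
have eps0 : 0 < (2 * n.+1%:R)^-1 :> R by rewrite invr_gt0 mulr_gt0.
have /fin_all_exists[N HN] (i : 'I_n.+1) : exists N, forall k, (N <= k)%N ->
    `|row i P *m A ^+ k| <= (2 * n.+1%:R)^-1 :> R.
  have := decay (_ : row i P *m c = 0); rewrite -row_mul Pc row0 => /(_ erefl).
  move=> /cvgrPdist_le/(_ _ eps0)[N _ H]; exists N => k /H.
  by rewrite sub0r normrN normr_id.
exists (\max_i N i)%N.+1 => // v; set k := (\max_i N i)%N.+1.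
have PAk : `|P *m A ^+ k| <= (2 * n.+1%:R)^-1.
  rewrite [leLHS]mx_normrE; apply/bigmax_leP; split; first exact: ltW.
  move=> [i j] _ /=.
  have -> : (P *m A ^+ k) i j = (row i P *m A ^+ k) 0 j.
    by rewrite -row_mul [RHS]mxE.
  have Nk : (N i <= k)%N by apply: leqW; exact: (@leq_bigmax _ N i).
  apply: le_trans (HN i k Nk).
  exact: le_mx_norm_entry.
rewrite -{1}PP mulmxA -mulmxA.
apply: le_trans (mx_norm_mul _ _) _.
apply: le_trans (ler_wpM2l _ PAk) _; first by rewrite mulr_ge0.
by rewrite le_eqVlt; apply/orP; left; apply/eqP; field; rewrite nat1r pnatr_eq0.
Qed.

(* Summing the norms of the first N iterates makes the contraction visible in
   one step. *)
Lemma adapted_seminorm : exists (T : 'rV[R]_n.+1 -> R) (theta C : R),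
  [/\ 0 <= theta < 1, 0 < C,
      (forall u v, T (u + v) <= T u + T v) /\ (forall a v, T (a *: v) = `|a| * T v),
      T e = 0 /\ (forall v, T (v *m A) <= theta * T v) &
      forall v, [/\ T v <= C * `|v|, `|(v *m c) 0 0| <= C * `|v| &
        `|v| <= C * (`|(v *m c) 0 0| + T v)]].
Proof.
have [[//|N] _ HN] := uniform_decay.
pose T (v : 'rV[R]_n.+1) : R := \sum_(k < N.+1) `|v *m P *m A ^+ k|.
pose K : R := \sum_(k < N.+1) n.+1%:R * `|A ^+ k| + 1.
have K1 : 1 <= K by rewrite lerDr sumr_ge0// => k _; rewrite mulr_ge0.
have K0 : 0 < K by rewrite (lt_le_trans ltr01).
have T_le v : T v <= K * `|v *m P|.
  rewrite mulrDl mul1r mulr_suml -[leLHS]addr0 lerD// ler_sum// => k _.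
  by apply: le_trans (mx_norm_mul _ _) _; rewrite mulrAC.
have P_le v : `|v *m P| <= T v.
  rewrite /T big_ord_recl /= expr0 mulmx1 lerDl.
  exact: sumr_ge0.
(* Telescoping: the sum loses its first term |v P| and gains a last one, which is at most half of
   it. *)
have TA v : T (v *m A) <= T v - 2^-1 * `|v *m P|.
  have -> : T (v *m A) = \sum_(k < N.+1) `|v *m P *m A ^+ k.+1|.
    apply: eq_bigr => k _.
    by rewrite -(mulmxA v) -PA mulmxA -mulmxA -[A *m _]/(A * _) -exprS.
  have := HN v; rewrite big_ord_recr /T big_ord_recl /= expr0 mulmx1.
  under [X in _ <= _ + X - _]eq_bigr do rewrite /bump /= add1n.
  lra.
(* [theta] combines the loss of |v P| / 2 with T v <= K |v P|. The summands of the constant serve,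
   in turn, the bound on T, the bound on pi, and the splitting v = v P + pi(v) e. *)
exists T, (1 - (2 * K)^-1), (K * (n.+1%:R * `|P|) + n.+1%:R * `|c| + `|e| + 1); split.
- rewrite ltrBlDr ltrDl invr_gt0 mulr_gt0// andbT subr_ge0 invf_le1 ?mulr_gt0//; lra.
- by rewrite ltr_wpDl// !addr_ge0// !mulr_ge0// ltW.
- split=> [u v|a v].
    rewrite -big_split /=; apply: ler_sum => k _.
    by rewrite !mulmxDl ler_normD.
  by rewrite mulr_sumr; apply: eq_bigr => k _; rewrite -!scalemxAl normrZ.
- split=> [|v].
    by rewrite /T big1// => k _; rewrite eP mul0mx normr0.
  apply: le_trans (TA v) _; rewrite mulrBl mul1r lerD2l lerN2 invfM -mulrA.
  by rewrite ler_wpM2l// ler_pdivrMl.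
have CP0 : 0 <= K * (n.+1%:R * `|P|) by rewrite !mulr_ge0// ltW.
have Cc0 : 0 <= n.+1%:R * `|c| by rewrite mulr_ge0.
have Ce0 : 0 <= `|e| by [].
move=> v; set C1 := K * (n.+1%:R * `|P|) in CP0 *.
set C2 := n.+1%:R * `|c| in Cc0 *.
have v0 : 0 <= `|v| by [].
split.
- apply: (@le_trans _ _ (C1 * `|v|)); last first.
    by rewrite ler_wpM2r//; lra.
  apply: le_trans (T_le v) _; rewrite /C1 -!mulrA ler_wpM2l ?(ltW K0)//.
  by apply: le_trans (mx_norm_mul _ _) _; rewrite mulrAC mulrA.
- apply: (@le_trans _ _ (C2 * `|v|)); last first.
    by rewrite ler_wpM2r//; lra.
  apply: (@le_trans _ _ `|v *m c|).
    exact: le_mx_norm_entry.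
  by apply: le_trans (mx_norm_mul _ _) _; rewrite mulrAC.
- have Tv0 : 0 <= T v by apply: sumr_ge0.
  rewrite {1}(vP v); apply: le_trans (ler_normD _ _) _.
  rewrite normrZ addrC; set a := `|_|.
  have a0 : 0 <= a by exact: normr_ge0.
  have := P_le v.
  have : 0 <= C1 * (a + T v) by rewrite mulr_ge0// addr_ge0.
  have : 0 <= C2 * (a + T v) by rewrite mulr_ge0// addr_ge0.
  have : 0 <= `|e| * T v by rewrite mulr_ge0.
  lra.
Qed.

End adapted_seminorm.

Section cone.
Variables (R : realType) (n : nat) (A : 'M[R]_n.+1) (e : 'rV[R]_n.+1)
  (c : 'cV[R]_n.+1) (mu : R) (T : 'rV[R]_n.+1 -> R) (theta kappa : R)
  (near_A : 'M[R]_n.+1 -> Prop).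
Hypotheses (ec : e *m c = 1%:M) (Ac : A *m c = mu *: c)
  (TD : forall u v, T (u + v) <= T u + T v)
  (TZ : forall a v, T (a *: v) = `|a| * T v) (Te : T e = 0)
  (TA : forall v, T (v *m A) <= theta * T v)
  (kappa0 : 0 <= kappa) (theta0 : 0 <= theta) (theta1 : theta < 1) (mu1 : 1 < `|mu|).

Let pi (v : 'rV[R]_n.+1) : R := (v *m c) 0 0.

Hypotheses (kappa_mu : 2 * kappa <= `|mu| - 1)
  (kappa_theta : 4 * kappa <= 1 - theta)
  (near_pi : forall J v, near_A J -> `|pi (v *m (J - A))| <= kappa * (`|pi v| + T v))
  (near_T : forall J v, near_A J -> T (v *m (J - A)) <= kappa * (`|pi v| + T v)).

(** Aperture of the narrow cone T v <= g pi v: one step multiplies the aperture 1 by at most theta +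
    2 kappa, which is at most g because 4 kappa <= 1 - theta. *)
Let g : R := (1 + theta) / 2.

Let g_gt0 : 0 < g.
Proof. by rewrite divr_gt0// ltr_pwDl. Qed.

Let g_lt1 : g < 1.
Proof. by rewrite /g ltr_pdivrMr// mul1r ltrD2l. Qed.

Let T_ge0 v : 0 <= T v.
Proof.
have := TD v (- v); rewrite subrr -{1}(scale0r v) -scaleN1r !TZ normr0.
by rewrite normrN normr1; lra.
Qed.

Let piD u v : pi (u + v) = pi u + pi v.
Proof. by rewrite /pi mulmxDl mxE. Qed.

Let piZ a v : pi (a *: v) = a * pi v.
Proof. by rewrite /pi -scalemxAl mxE. Qed.

Let pie : pi e = 1.
Proof. by rewrite /pi ec mxE eqxx. Qed.

Let piA v : pi (v *m A) = mu * pi v.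
Proof. by rewrite /pi -mulmxA Ac -scalemxAr mxE. Qed.

Let sgmu : `|Num.sg mu| = 1.
Proof. by rewrite normr_sg -normr_gt0 (lt_trans ltr01). Qed.

Let mulJ (J : 'M[R]_n.+1) (v : 'rV[R]_n.+1) : v *m J = v *m A + v *m (J - A).
Proof. by rewrite mulmxBr addrC subrK. Qed.

(** On the cone the error v (J - A) is at most 2 kappa pi(v), both in pi and in T. It is dominated
    by the expansion |mu| - 1 of pi and by the contraction 1 - theta of T. The sign of mu keeps the
    image in the same half of the cone. *)
Lemma cone_step J v : near_A J -> T v <= pi v ->
  let u := Num.sg mu *: (v *m J) in
  [/\ pi v <= pi u, pi u <= (`|mu| + 2 * kappa) * pi v & T u <= g * pi u].
Proof.
move=> JA Tv u; have pv0 : 0 <= pi v by exact: le_trans Tv.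
have k0 : 0 <= kappa * (`|pi v| + T v) by exact: le_trans (near_T _ JA).
have npi := near_pi v JA; have nT := near_T v JA.
have kle : kappa * (`|pi v| + T v) <= 2 * kappa * pi v.
  by rewrite ger0_norm// -mulrA mulrCA ler_wpM2l//; lra.
have piu : pi u = `|mu| * pi v + Num.sg mu * pi (v *m (J - A)).
  by rewrite /u piZ mulJ piD piA mulrDr mulrA -normrEsg.
have := ler_norm (Num.sg mu * pi (v *m (J - A))).
have := ler_norm (- (Num.sg mu * pi (v *m (J - A)))).
rewrite normrN normrM sgmu mul1r => H1 H2.
have Tu : T u <= theta * T v + T (v *m (J - A)).
  by rewrite /u TZ sgmu mul1r mulJ (le_trans (TD _ _))// lerD2r.
have k1 : 2 * kappa * pi v <= (`|mu| - 1) * pi v by rewrite ler_wpM2r.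
have k2 : 4 * kappa * pi v <= (1 - theta) * pi v by rewrite ler_wpM2r.
have k3 : theta * T v <= theta * pi v by rewrite ler_wpM2l.
have piu1 : pi v <= pi u by lra.
split => //; first by lra.
have g0 : 0 <= g by rewrite ltW.
apply: (@le_trans _ _ (g * pi v)); last exact: ler_wpM2l.
by rewrite /g; lra.
Qed.

Lemma cone_step_abs J v : near_A J -> T v <= `|pi v| ->
  T (v *m J) <= g * `|pi (v *m J)|.
Proof.
move=> JA.
have pos u : T u <= pi u -> T (u *m J) <= g * `|pi (u *m J)|.
  move=> /(cone_step JA)[_ _]; rewrite TZ piZ sgmu mul1r => /le_trans; apply.
  rewrite ler_wpM2l ?(ltW g_gt0)// (le_trans (ler_norm _))//.
  by rewrite normrM sgmu mul1r.
have [v0|v0] := leP 0 (pi v); first by rewrite ger0_norm//; exact: pos.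
rewrite ltr0_norm// => Tv; have := pos (-1 *: v).
rewrite -scalemxAl !TZ !piZ normrM normrN normr1 !mul1r mulN1r.
exact.
Qed.

(** Forward invariance of the cone puts v outside it as well; there the error is at most 2 kappa T
    v, less than what A contracts. *)
Lemma outside_cone_step J v : near_A J -> `|pi (v *m J)| < T (v *m J) ->
  `|pi v| < T v /\ T (v *m J) <= T v.
Proof.
move=> JA out.
have Tv : `|pi v| < T v.
  rewrite ltNge; apply/negP => /(cone_step_abs JA) inside.
  by move: out; rewrite ltNge (le_trans inside)// ler_piMl// ltW.
split => //.
have nT := near_T v JA.
rewrite [in leLHS]mulJ (le_trans (TD _ _))//.
have k1 : kappa * (`|pi v| + T v) <= kappa * (2 * T v).
  by rewrite ler_wpM2l//; lra.
have k2 : 4 * kappa * T v <= (1 - theta) * T v by rewrite ler_wpM2r.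
have k3 : 0 <= (1 - theta) * T v by rewrite mulr_ge0// subr_ge0 ltW.
have := TA v; lra.
Qed.

Section cocycle.
Variables (X : Type) (f : X -> X) (D : nat -> X -> 'M[R]_n.+1).
Hypotheses (D0 : forall x, D 0 x = 1%:M) (D1 : forall x, near_A (D 1 x))
  (DD : forall k l x, D (k + l)%N x = D k x *m D l (iter k f x)).

(* The sign makes this |pi (e D_k)|, without an absolute value to integrate. *)
Definition expansion (k : nat) (x : X) : R :=
  Num.sg mu ^+ k * (e *m D k x *m c) 0 0.

Let DS k x : D k.+1 x = D k x *m D 1 (iter k f x).
Proof. by rewrite -DD addn1. Qed.

Let sDS k x (v : 'rV[R]_n.+1) : Num.sg mu ^+ k.+1 *: (v *m D k.+1 x) =
  Num.sg mu *: (Num.sg mu ^+ k *: (v *m D k x) *m D 1 (iter k f x)).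
Proof. by rewrite DS mulmxA -scalemxAl scalerA exprS. Qed.

Lemma cone_iter k x v : T v <= pi v ->
  let u := Num.sg mu ^+ k *: (v *m D k x) in pi v <= pi u /\ T u <= pi u.
Proof.
move=> Tv; elim: k => [|k [IH1 IH2]]; first by rewrite expr0 scale1r D0 mulmx1.
rewrite sDS; have [H1 _ H2] := cone_step (D1 (iter k f x)) IH2.
split; first exact: le_trans H1.
apply: le_trans H2 _; rewrite ler_piMl ?(ltW g_lt1)//.
by rewrite (le_trans _ H1)// (le_trans _ IH1)// (le_trans _ Tv).
Qed.

Lemma narrow_cone_iter k x v : T v <= g * pi v ->
  let u := Num.sg mu ^+ k *: (v *m D k x) in T u <= g * pi u.
Proof.
move=> Tv.
have pv : 0 <= pi v.
  by have := le_trans (T_ge0 v) Tv; rewrite pmulr_rge0.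
case: k => [|k]; first by rewrite expr0 scale1r D0 mulmx1.
have [|H1 H2] := @cone_iter k x v.
  by apply: le_trans Tv _; rewrite ler_piMl ?(ltW g_lt1).
by rewrite sDS; have [] := cone_step (D1 (iter k f x)) H2.
Qed.

(* The functional v |-> pi (v D_k) is positive on the cone, hence comparable on
   the narrow cone to its value at the center e. *)
Lemma expansion_comparable k x v : T v <= g * pi v ->
  (1 - g) * pi v * expansion k x <= Num.sg mu ^+ k * pi (v *m D k x)
    <= (1 + g) * pi v * expansion k x.
Proof.
move=> Tv; have g0 := g_gt0.
have psi_ge0 w : T w <= pi w -> 0 <= Num.sg mu ^+ k * pi (w *m D k x).
  move=> Tw; have [H _] := cone_iter k x Tw; rewrite -piZ (le_trans _ H)//.
  exact: le_trans Tw.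
pose w := v + (- pi v) *: e.
have piw : pi w = 0 by rewrite piD piZ pie mulr1 subrr.
have Tw : T w <= g * pi v.
  by apply: le_trans (TD _ _) _; rewrite TZ Te mulr0 addr0.
(* The vectors pi(v) e + s w with |s| = 1 / g still lie in the cone; the two signs of s give the two
   bounds. *)
have H s : `|s| = g^-1 -> 0 <= pi v * expansion k x +
    s * (Num.sg mu ^+ k * pi (w *m D k x)).
  move=> sg; have := psi_ge0 (pi v *: e + s *: w).
  rewrite mulmxDl -!scalemxAl !piD !piZ piw pie mulr0 addr0 mulr1.
  have TT : T (pi v *: e + s *: w) <= pi v.
    rewrite (le_trans (TD _ _))// !TZ Te mulr0 add0r sg.
    by rewrite ler_pdivrMl.
  by move=> /(_ TT); rewrite mulrDr mulrCA [_ * (s * _)]mulrCA.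
have vE : Num.sg mu ^+ k * pi (v *m D k x) =
    pi v * expansion k x + Num.sg mu ^+ k * pi (w *m D k x).
  by rewrite /w mulmxDl -scalemxAl piD piZ /expansion -/(pi _); ring.
have gV : `|g^-1| = g^-1 by rewrite ger0_norm// invr_ge0 ltW.
rewrite vE; have H2 := H _ gV; have := H (- g^-1).
rewrite normrN => /(_ gV) H1.
move: H1 H2; rewrite mulNr; set y := _ * pi (w *m _).
set q := pi v * _ => H1 H2.
have {}H1 : 0 <= g * (q - g^-1 * y) by rewrite mulr_ge0// ltW.
have {}H2 : 0 <= g * (q + g^-1 * y) by rewrite mulr_ge0// ltW.
move: H1 H2; rewrite mulrBr mulrDr !mulVKf ?gt_eqF// => H1 H2.
rewrite -!mulrA -/q mulrBl mulrDl !mul1r !lerD2l.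
by rewrite lerNl -subr_ge0 opprK H2 -subr_ge0 H1.
Qed.

Lemma expansion_comparable_abs k x v : T v <= g * `|pi v| ->
  T (v *m D k x) <= `|pi (v *m D k x)| /\
  (1 - g) * `|pi v| * expansion k x <= `|pi (v *m D k x)|
    <= (1 + g) * `|pi v| * expansion k x.
Proof.
have [s s1 sv] : exists2 s : R, `|s| = 1 & s * pi v = `|pi v|.
  have [v0|v0] := leP 0 (pi v); first by exists 1; rewrite ?normr1// mul1r ger0_norm.
  by exists (-1); rewrite ?normrN ?normr1// mulN1r ltr0_norm.
move=> Tv; have Tsv : T (s *: v) <= g * pi (s *: v) by rewrite TZ piZ sv s1 mul1r.
have Tsv1 : T (s *: v) <= pi (s *: v).
  by rewrite (le_trans Tsv)// ler_piMl ?(ltW g_lt1)// piZ sv.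
have norm_k : `|Num.sg mu ^+ k * pi (s *: v *m D k x)| = `|pi (v *m D k x)|.
  by rewrite -scalemxAl piZ !normrM normrX sgmu expr1n s1 !mul1r.
have [pos cone] := cone_iter k x Tsv1; split.
  move: cone; rewrite -scalemxAl !TZ s1 normrX sgmu expr1n !mul1r.
  move=> /le_trans; apply; rewrite !piZ (le_trans (ler_norm _))//.
  by rewrite !normrM normrX sgmu expr1n s1 !mul1r.
have psi_ge0 : 0 <= Num.sg mu ^+ k * pi (s *: v *m D k x).
  by rewrite -piZ (le_trans _ pos)// piZ sv.
rewrite -norm_k (ger0_norm psi_ge0).
by have := expansion_comparable k x Tsv; rewrite [pi (s *: v)]piZ sv.
Qed.

Lemma expansion_ge1 k x : 1 <= expansion k x.
Proof.
have Tee : T e <= pi e by rewrite Te pie.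
by have [] := cone_iter k x Tee; rewrite piZ pie.
Qed.

Lemma expansion1_le x : expansion 1 x <= `|mu| + 2 * kappa.
Proof.
have Tee : T e <= pi e by rewrite Te pie.
have [_ + _] := cone_step (D1 x) Tee.
by rewrite piZ pie mulr1 /expansion expr1.
Qed.

(** The comparison on the narrow cone is applied to e D_k: b_(k+l) equals b_k b_l up to a factor
    between 1 - g and 1 + g. *)
Lemma ln_expansion_near_additive : exists K : R,
  (forall k l x, `|ln (expansion (k + l)%N x) - ln (expansion k x) -
      ln (expansion l (iter k f x))| <= K) /\
  (forall x, `|ln (expansion 1 x)| <= K).
Proof.
have g0 := g_gt0.
have g1 : 0 < 1 - g by rewrite subr_gt0.
have b0 k x : 0 < expansion k x by exact: lt_le_trans (expansion_ge1 k x).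
have lnle (a b : R) : 0 < a -> a <= b -> ln a <= ln b.
  by move=> a0 ab; rewrite ler_ln// posrE (lt_le_trans a0).
exists (`|ln (1 - g)| + `|ln (1 + g)| + `|ln (`|mu| + 2 * kappa)|); split.
  move=> k l x; pose u := Num.sg mu ^+ k *: (e *m D k x).
  have Tu : T u <= g * pi u.
    by apply: narrow_cone_iter; rewrite Te pie mulr1 ltW.
  have := expansion_comparable l (iter k f x) Tu.
  have -> : pi u = expansion k x by rewrite piZ.
  have -> : Num.sg mu ^+ l * pi (u *m D l (iter k f x)) = expansion (k + l) x.
    by rewrite -scalemxAl piZ -mulmxA -DD mulrA -exprD addnC.
  rewrite -[(1 - g) * _ * _]mulrA -[(1 + g) * _ * _]mulrA => /andP[lo hi].
  have pos : 0 < expansion k x * expansion l (iter k f x) by rewrite mulr_gt0.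
  have : ln ((1 - g) * (expansion k x * expansion l (iter k f x))) <=
      ln (expansion (k + l) x).
    exact: lnle (mulr_gt0 g1 pos) lo.
  have : ln (expansion (k + l) x) <=
      ln ((1 + g) * (expansion k x * expansion l (iter k f x))).
    by apply: lnle hi.
  have lnb : ln (expansion k x * expansion l (iter k f x)) =
      ln (expansion k x) + ln (expansion l (iter k f x)).
    by rewrite lnM// posrE.
  rewrite [ln ((1 - g) * _)]lnM ?posrE// [ln ((1 + g) * _)]lnM ?posrE ?addr_gt0// lnb.
  have := ler_norm (ln (1 + g)); have := ler_norm (- ln (1 - g)).
  have := normr_ge0 (ln (1 + g)); have := normr_ge0 (ln (1 - g)).
  have := normr_ge0 (ln (`|mu| + 2 * kappa)).
  by rewrite normrN => *; rewrite ler_norml; apply/andP; split; lra.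
move=> x.
have ln0 : 0 <= ln (expansion 1 x) by apply: ln_ge0; exact: expansion_ge1.
have : ln (expansion 1 x) <= ln (`|mu| + 2 * kappa).
  by apply: lnle (expansion1_le x).
have := ler_norm (ln (`|mu| + 2 * kappa)).
rewrite (ger0_norm ln0).
have := normr_ge0 (ln (1 + g)); have := normr_ge0 (ln (1 - g)).
lra.
Qed.

(** * Unstable subspaces of an orbit and their expansion *)

Section unstable_subspaces.
Variables (C C' lam : R) (x : int -> X) (Es Eu : int -> 'M[R]_n.+1).
Hypotheses (C0 : 0 < C) (T_le : forall v, T v <= C * `|v|)
  (pi_le : forall v, `|pi v| <= C * `|v|)
  (norm_le : forall v : 'rV[R]_n.+1, `|v| <= C * (`|pi v| + T v)).
Hypotheses (C'0 : 0 < C') (lam1 : 1 < lam) (xf : forall i, f (x i) = x (i + 1))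
  (EsEu : (Es 0 + Eu 0 :=: 1%:M)%MS)
  (EuD : forall i, (Eu i *m D 1 (x i) :=: Eu (i + 1))%MS)
  (Eu_expanded : forall (i : int) (k : nat) (v : 'rV[R]_n.+1), (0 < k)%N ->
     (v <= Eu i)%MS -> C'^-1 * lam ^+ k * enorm v <= enorm (v *m D k (x i)))
  (Es_contracted : forall (i : int) (k : nat) (v : 'rV[R]_n.+1), (0 < k)%N ->
     (v <= Es i)%MS -> enorm (v *m D k (x i)) <= C' * lam ^- k * enorm v).

Let iter_orbit k j : iter k f (x j) = x (j + k%:Z).
Proof.
elim: k => [|k IH]; first by rewrite addr0.
by rewrite iterS IH xf -[k.+1]addn1 PoszD addrA.
Qed.

Let backward k i (v : 'rV[R]_n.+1) : (v <= Eu i)%MS ->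
  exists2 u : 'rV[R]_n.+1, (u <= Eu (i - k%:Z)%R)%MS & v = u *m D k (x (i - k%:Z)).
Proof.
elim: k i v => [|k IH] i v vE.
  by exists v; rewrite ?subr0// D0 mulmx1.
have : (v <= Eu (i - 1) *m D 1 (x (i - 1)))%MS by rewrite EuD subrK.
move=> /submxP[w vw].
have [u uE wu] := IH (i - 1) (w *m Eu (i - 1)) (submxMl _ _).
have jE : i - k.+1%:Z = i - 1 - k%:Z by rewrite intS opprD addrA.
exists u; first by rewrite jE.
by rewrite jE DS iter_orbit subrK mulmxA -wu -mulmxA.
Qed.

Let outside_iter k y v : `|pi (v *m D k y)| < T (v *m D k y) ->
  T (v *m D k y) <= T v.
Proof.
elim: k => [|k IH]; first by rewrite D0 mulmx1.
rewrite DS mulmxA => /(outside_cone_step (D1 _))[out le_T].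
exact: le_trans le_T (IH out).
Qed.

(* Outside the cone T does not decrease along backward orbits, whereas vectors
   of Eu decay. *)
Let unstable_in_cone i (v : 'rV[R]_n.+1) : (v <= Eu i)%MS -> T v <= `|pi v|.
Proof.
move=> vE; rewrite leNgt; apply/negP => out.
have Tv : 0 < T v by exact: le_lt_trans out.
(* If u is the preimage of v after k steps back, then T v <= T u <= C |u| <= C C' lam^-k |v|, which
   this k makes smaller than T v. *)
have [k k0 kB] := expr_unbounded (C * C' * enorm v / T v) lam1.
have [u uE vu] := backward k vE.
have := Eu_expanded k0 uE; rewrite -vu => exp_u.
have Tu : T v <= C * enorm u.
  apply: (@le_trans _ _ (T u)); first by rewrite vu outside_iter -?vu.
  by rewrite (le_trans (T_le u))// ler_wpM2l ?(ltW C0)// mx_norm_le_enorm.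
have lamk : 0 < lam ^+ k by rewrite exprn_gt0// (lt_trans ltr01).
have exp_u' : lam ^+ k * enorm u <= C' * enorm v.
  by rewrite -ler_pdivrMl// mulrA.
move: kB; rewrite ltNge => /negP; apply.
rewrite ler_pdivlMr// (le_trans (ler_wpM2l (ltW lamk) Tu))//.
by rewrite mulrCA -mulrA ler_wpM2l// ltW.
Qed.

(** The preimage one step back is already in the cone, and one step forward narrows it. *)
Let unstable_in_narrow_cone i (v : 'rV[R]_n.+1) : (v <= Eu i)%MS -> T v <= g * `|pi v|.
Proof.
move=> /(backward 1)[u uE ->]; apply: cone_step_abs; first exact: D1.
exact: unstable_in_cone uE.
Qed.

Let pi_iter_e k y : expansion k y <= `|pi (e *m D k y)|.
Proof.
rewrite (le_trans (ler_norm _))// normrM normrX sgmu expr1n mul1r.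
exact: lexx.
Qed.

(** If [Eu 0] vanished, e would be a stable vector, although |pi (e D_k)| >= 1 for all k. Without a
    unit vector the supremum in [restr_norm] would be over the empty set. *)
Let unstable_nonzero : exists2 v : 'rV[R]_n.+1, (v <= Eu 0)%MS & enorm v = 1.
Proof.
have [E0|/rowV0Pn[v vE v0]] := eqVneq (Eu 0) 0; last first.
  have nv : enorm v != 0.
    have : 0 < `|v| by rewrite normr_gt0.
    by move=> /lt_le_trans/(_ (mx_norm_le_enorm v)); rewrite lt_neqAle eq_sym => /andP[].
  exists ((enorm v)^-1 *: v); first exact: scalemx_sub.
  by rewrite enormZ ger0_norm ?invr_ge0 ?enorm_ge0// mulVf.
have eEs : (e <= Es 0)%MS.
  apply: (submx_trans (submx1 e)); rewrite -EsEu E0.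
  by rewrite addsmx0 submx_refl.
have [k k0 kB] := expr_unbounded (C * C' * enorm e) lam1.
have lamk : 0 < lam ^+ k by rewrite exprn_gt0// (lt_trans ltr01).
have := Es_contracted k0 eEs => contr.
have b1 := expansion_ge1 k (x 0).
have : 1 <= C * (C' * lam ^- k * enorm e).
  apply: le_trans b1 _; apply: le_trans (pi_iter_e _ _) _.
  apply: le_trans (pi_le _) _; rewrite ler_wpM2l ?(ltW C0)//.
  exact: le_trans (mx_norm_le_enorm _) contr.
have -> : C * (C' * lam ^- k * enorm e) = C * C' * enorm e / lam ^+ k.
  by rewrite -mulrA [lam ^- k * _]mulrC !mulrA.
by rewrite ler_pdivlMr// mul1r leNgt kB.
Qed.

(** Unstable vectors and their images lie in the cone, where the norm and |pi| are comparable; so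
    every unit vector of [E] is stretched by b_k up to constants independent of k. *)
Lemma restr_norm_expansion (E : 'M[R]_n.+1) : (E :=: Eu 0)%MS ->
  exists k1 k2 : R, 0 < k1 /\ forall k,
    k1 * expansion k (x 0) <= restr_norm (D k (x 0)) E <= k2 * expansion k (x 0).
Proof.
move=> EE.
have [NC NC0 in_cone_norm] : exists2 NC : R, 0 < NC &
    forall w, T w <= `|pi w| -> enorm w <= NC * `|pi w|.
  have N0 : 0 < n.+1%:R :> R by rewrite ltr0n.
  exists (n.+1%:R * (C * 2)); first by rewrite !mulr_gt0.
  move=> w Tw; apply: le_trans (enorm_le_mx_norm w) _.
  rewrite -mulrA ler_wpM2l ?(ltW N0)// -mulrA.
  by apply: le_trans (norm_le w) _; rewrite ler_wpM2l ?(ltW C0)//; lra.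
have g2 : 0 < 1 + g by rewrite addr_gt0.
have pi_enorm w : `|pi w| <= C * enorm w.
  by rewrite (le_trans (pi_le w))// ler_wpM2l ?(ltW C0)// mx_norm_le_enorm.
have g1 : 0 < 1 - g by rewrite subr_gt0.
have bounds k (v : 'rV[R]_n.+1) : (v <= E)%MS -> enorm v = 1 ->
    (1 - g) / (NC * C) * expansion k (x 0) <= enorm (v *m D k (x 0)) <=
    NC * (1 + g) * C * expansion k (x 0).
  rewrite EE => vE v1.
  have Tv := unstable_in_narrow_cone vE.
  have b0 : 0 <= expansion k (x 0) by rewrite (le_trans ler01)// expansion_ge1.
  have [Tvk cmp] := expansion_comparable_abs k (x 0) Tv.
  have /andP[lo hi] := cmp.
  have H1 := in_cone_norm _ Tvk; have H2 := pi_enorm (v *m D k (x 0)).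
  have H3 : `|pi v| <= C by rewrite (le_trans (pi_enorm v))// v1 mulr1.
  have H4 : 1 <= NC * `|pi v|.
    have := in_cone_norm v; rewrite v1; apply; rewrite (le_trans Tv)//.
    by rewrite ler_piMl// ltW.
  apply/andP; split.
    rewrite -(ler_pM2l C0) (le_trans _ H2)// (le_trans _ lo)//.
    rewrite mulrA ler_wpM2r// mulrCA ler_wpM2l ?(ltW g1)//.
    by rewrite invfM mulrCA mulfV ?gt_eqF// mulr1 -[leLHS]mulr1 ler_pdivrMl.
  apply: le_trans H1 _; rewrite -(mulrA NC) -(mulrA NC) ler_wpM2l ?(ltW NC0)//.
  by apply: le_trans hi _; rewrite ler_wpM2r// ler_wpM2l ?(ltW g2).
have [v0 v0E v01] := unstable_nonzero.
have v0E' : (v0 <= E)%MS by rewrite EE.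
exists ((1 - g) / (NC * C)), (NC * (1 + g) * C); split.
  by rewrite divr_gt0// mulr_gt0.
move=> k; pose S := [set enorm (v *m D k (x 0)) | v in [set v | (v <= E)%MS /\ enorm v = 1]].
have S0 : S (enorm (v0 *m D k (x 0))) by exists v0.
have ubS : ubound S (NC * (1 + g) * C * expansion k (x 0)).
  by move=> _ [v [vE v1] <-]; have /andP[] := bounds k v vE v1.
apply/andP; split; last by apply: ge_sup => //; exists (enorm (v0 *m D k (x 0))).
have /andP[lo _] := bounds k v0 v0E' v01.
by apply: le_trans lo _; apply: ub_le_sup => //; exists (NC * (1 + g) * C * expansion k (x 0)).
Qed.

End unstable_subspaces.
End cocycle.
End cone.

(** * Lifts of torus maps *)

Lemma proj_eqP (R : realType) (n : nat) (x y : 'rV[R]_n) :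
  proj x = proj y <-> forall i, (x - y) 0 i \is a Num.int.
Proof.
split=> [/eqmodP /forallP xy i|xy]; first by rewrite !mxE; exact: xy.
by apply/eqmodP/forallP => i; have := xy i; rewrite !mxE.
Qed.

Lemma proj_repr (R : realType) (n : nat) (p : torus R n) : proj (repr p) = p.
Proof. exact: reprK. Qed.

Section lifts.
Variables (R : realType) (n : nat) (f : torus R n -> torus R n)
  (F : 'rV[R]_n -> 'rV[R]_n).
Hypothesis liftF : C1_lift f F.

Lemma lift_proj x : proj (F x) = f (proj x).
Proof. exact: liftF.1. Qed.

Lemma lift_differentiable x : differentiable F x.
Proof. exact: (liftF.2 x I).1. Qed.

Lemma lift_continuous : continuous F.
Proof. by move=> x; exact/differentiable_continuous/lift_differentiable. Qed.

Lemma lift_jacobian_continuous : continuous (jacobian F).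
Proof. by move=> x; exact: (liftF.2 x I).2. Qed.

(** The difference F(z + k) - F(z) is continuous in z and integral, because z and z + k project to
    the same point. *)
Lemma lift_shift_const (k x y : 'rV[R]_n) : (forall i, k 0 i \is a Num.int) ->
  F (x + k) - F x = F (y + k) - F y.
Proof.
move=> kint; apply/rowP => i.
apply: (@int_valued_const R n (fun z => (F (z + k) - F z) 0 i)) => [|z].
  have kc : continuous (fun z : 'rV[R]_n => z + k).
    by move=> z; apply: (@continuousD _ _ _ id (fun=> k) z) => //;
      exact: cst_continuous.
  have dc : continuous (fun z : 'rV[R]_n => F (z + k) - F z).
    move=> z; apply: (@cvgB _ _ _ (nbhs (z : 'rV[R]_n)) _ (fun z => F (z + k)) F).
      exact: (@continuous_comp _ _ _ (fun z : 'rV[R]_n => z + k) F z (kc z)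
        (@lift_continuous (z + k))).
    exact: lift_continuous.
  by move=> z; exact: (@continuous_entry R _ 1 n _ z 0 i (dc z)).
have /proj_eqP -> // : proj (F (z + k)) = proj (F z).
by rewrite !lift_proj; congr f; apply/proj_eqP => j; rewrite [z + k]addrC addrK.
Qed.

Lemma jacobian_shift (k x : 'rV[R]_n) : (forall i, k 0 i \is a Num.int) ->
  jacobian F (x + k) = jacobian F x.
Proof.
move=> kint; apply: jacobian_eqP => [| |h]; try exact: lift_differentiable.
rewrite addrA; have /eqP := lift_shift_const (h + x) x kint.
rewrite subr_eq => /eqP->.
by rewrite [LHS]addrAC [F (x + k) - _ - _]addrAC subrr sub0r addrC.
Qed.

Lemma jacobian_lift_unique G x : C1_lift f G -> jacobian F x = jacobian G x.
Proof.
move=> liftG.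
apply: jacobian_eqP => [| |h]; first exact: lift_differentiable.
  exact: (liftG.2 x I).1.
apply/rowP => i.
have dc : continuous (fun z : 'rV[R]_n => F z - G z).
  move=> z; apply: (@cvgB _ _ _ (nbhs (z : 'rV[R]_n)) _ F G).
    exact: lift_continuous.
  exact/differentiable_continuous/(liftG.2 z I).1.
have := @int_valued_const R n (fun z => (F z - G z) 0 i) _ _ (h + x) x.
rewrite !mxE => H.
have {}H : F (h + x) 0 i - G (h + x) 0 i = F x 0 i - G x 0 i.
  have -> : F (h + x) 0 i - G (h + x) 0 i = (F (h + x) - G (h + x)) 0 i by rewrite !mxE.
  have -> : F x 0 i - G x 0 i = (F x - G x) 0 i by rewrite !mxE.
  apply: (@int_valued_const R n (fun z => (F z - G z) 0 i)) => z.
    exact: (@continuous_entry R _ 1 n _ z 0 i (dc z)).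
  have /proj_eqP -> // : proj (F z) = proj (G z).
  by rewrite lift_proj liftG.1.
lra.
Qed.

(** The choices made by [xget] and [repr] disappear, by uniqueness up to integers and by periodicity
    respectively. *)
Lemma tderivE x : tderiv f (proj x) = jacobian F x.
Proof.
rewrite /tderiv (_ : repr (proj x) = x + (repr (proj x) - x)); last first.
  by rewrite addrC subrK.
have lf : C1_lift f (lift_of f) by apply: xgetPex; exists F.
rewrite -(@jacobian_lift_unique _ _ lf) jacobian_shift// => i.
by apply/(proj_eqP _ _).1; rewrite proj_repr.
Qed.

End lifts.

Lemma C1_lift_comp (R : realType) (n : nat) (f g : torus R n -> torus R n) F G :
  C1_lift f F -> C1_lift g G -> C1_lift (g \o f) (G \o F).
Proof.
move=> lF lG; split=> [x|x _].
  by rewrite /= (lift_proj lG) (lift_proj lF).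
have dF := lift_differentiable lF; have dG := lift_differentiable lG.
split; first exact: differentiable_comp.
have -> : jacobian (G \o F) = fun y => jacobian F y *m jacobian G (F y).
  by apply/funext => y; exact: jacobian_comp.
have h1 : {for x, continuous (jacobian F)}.
  exact: (@lift_jacobian_continuous _ _ _ _ lF x).
have h2 : {for x, continuous (fun y => jacobian G (F y))}.
  exact: (@continuous_comp _ _ _ F (jacobian G) x
    (@lift_continuous _ _ _ _ lF x) (@lift_jacobian_continuous _ _ _ _ lG (F x))).
exact: (continuous_mulmx h1 h2).
Qed.

Lemma C1_on_mulmxr (R : realType) (n : nat) (A : 'M[R]_n) :
  C1_on setT (mulmxr A : 'rV[R]_n -> 'rV[R]_n).
Proof.
move=> x _; split; first exact: differentiable_mulmxr.
have -> : jacobian (mulmxr A : 'rV[R]_n -> 'rV[R]_n) = fun=> A.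
  by apply/funext => y; exact: jacobian_mulmxr.
exact: cst_continuous.
Qed.

Lemma C1_lift_id (R : realType) (n : nat) : C1_lift (@id (torus R n)) id.
Proof.
split=> //.
have -> : @id 'rV[R]_n = mulmxr 1%:M by apply/funext => y; rewrite /= mulmx1.
exact: C1_on_mulmxr.
Qed.

Lemma tderiv_id (R : realType) (n : nat) (p : torus R n) : tderiv id p = 1%:M.
Proof.
rewrite -(proj_repr p) (tderivE (@C1_lift_id R n)).
have -> : @id 'rV[R]_n = mulmxr 1%:M by apply/funext => y; rewrite /= mulmx1.
exact: jacobian_mulmxr.
Qed.

Lemma C1_lift_iter (R : realType) (n : nat) (f : torus R n -> torus R n) F k :
  C1_lift f F -> C1_lift (iter k f) (iter k F).
Proof.
move=> lF; elim: k => [|k IH]; first exact: C1_lift_id.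
exact: C1_lift_comp IH lF.
Qed.

Lemma tderiv_iterD (R : realType) (n : nat) (f : torus R n -> torus R n) k l p :
  C1_map f ->
  tderiv (iter (k + l)%N f) p = tderiv (iter k f) p *m tderiv (iter l f) (iter k f p).
Proof.
case=> F lF; rewrite -(proj_repr p); set x := repr p.
have lk := C1_lift_iter k lF; have ll := C1_lift_iter l lF.
rewrite -(lift_proj lk) (tderivE lk) (tderivE ll).
have lkl : C1_lift (iter (k + l) f) (iter l F \o iter k F).
  have -> : iter (k + l) f = iter l f \o iter k f.
    by apply/funext => y; rewrite addnC iterD.
  exact: C1_lift_comp.
transitivity (jacobian (iter l F \o iter k F) x); first exact: tderivE.
exact: (jacobian_comp (lift_differentiable lk x) (lift_differentiable ll _)).
Qed.


Section torus_linear.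
Variables (R : realType) (n : nat) (A : 'M[int]_n).
Let AR : 'M[R]_n := map_mx intr A.

Lemma int_mulmx (k : 'rV[R]_n) : (forall i, k 0 i \is a Num.int) ->
  forall i, (k *m AR) 0 i \is a Num.int.
Proof.
move=> kint i; rewrite mxE rpred_sum// => j _; rewrite rpredM// mxE.
exact: intr_int.
Qed.

Lemma C1_lift_torus_linear : C1_lift (@torus_linear R n A) (mulmxr AR).
Proof.
split=> [x|]; last exact: C1_on_mulmxr.
apply/proj_eqP => i; rewrite /= -mulmxBl; apply: int_mulmx => j.
by apply/(proj_eqP _ _).1; rewrite proj_repr.
Qed.

Lemma tderiv_torus_linear p : tderiv (@torus_linear R n A) p = AR.
Proof.
rewrite -(proj_repr p) (tderivE C1_lift_torus_linear); exact: jacobian_mulmxr.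
Qed.

Variables (f : torus R n -> torus R n) (F : 'rV[R]_n -> 'rV[R]_n) (d : R).
Hypotheses (liftF : C1_lift f F) (d2 : d <= 2^-1)
  (f_near : forall p, exists x y : 'rV[R]_n,
    [/\ proj x = f p, proj y = torus_linear A p & `|x - y| < d]).

(** Each coordinate of F z - z A stays within d of the integers, so it varies by less than 2 d <= 1,
    while its change under an integer shift is an integer. Thus f acts as A on the fundamental
    group. *)
Lemma near_linear_shift (k x : 'rV[R]_n) : (forall i, k 0 i \is a Num.int) ->
  F (x + k) = F x + k *m AR.
Proof.
move=> kint; apply/rowP => i.
pose h (z : 'rV[R]_n) : R := (F z - z *m AR) 0 i.
have hc : continuous h.
  have dc : continuous (fun z : 'rV[R]_n => F z - z *m AR).
    move=> z; apply: (@cvgB _ _ _ (nbhs (z : 'rV[R]_n)) _ F (mulmxr AR)).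
      exact: (@lift_continuous _ _ _ _ liftF).
    exact: (differentiable_continuous (@differentiable_mulmxr R 1 n n AR z)).
  by move=> z; exact: (@continuous_entry R _ 1 n _ z 0 i (dc z)).
have h_near z : exists2 w : R, w \is a Num.int & `|h z - w| < d.
  have [u [v [fu fv uv]]] := f_near (proj z).
  have /proj_eqP/(_ i) H1 : proj (F z) = proj u by rewrite (lift_proj liftF).
  have /proj_eqP/(_ i) H2 : proj (z *m AR) = proj v.
    by rewrite fv; exact: C1_lift_torus_linear.1.
  exists ((F z - u) 0 i - (z *m AR - v) 0 i); first exact: rpredB.
  apply: le_lt_trans uv; apply: le_trans (le_mx_norm_entry _ 0 i).
  by rewrite le_eqVlt; apply/orP; left; apply/eqP; rewrite /h !mxE; congr `|_|; ring.
have hlt : `|h (x + k) - h x| < 2 * d by exact: near_int_bounded.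
have hint : h (x + k) - h x \is a Num.int.
  have -> : h (x + k) - h x = (F (x + k) - F x) 0 i - (k *m AR) 0 i.
    by rewrite /h mulmxDl !mxE; ring.
  apply: rpredB; last exact: int_mulmx.
  have /proj_eqP -> // : proj (F (x + k)) = proj (F x).
  rewrite !(lift_proj liftF); congr f; apply/proj_eqP => j.
  by rewrite [x + k]addrC addrK.
have h0 : h (x + k) - h x = 0.
  move: hint hlt => /intrP[m ->] mlt.
  have {}mlt : `|m%:~R| < 1 :> R by apply: lt_le_trans mlt _; have := d2; lra.
  by move: mlt; rewrite -intr_norm (ltr_int _ _ 1) => mlt; apply/eqP; rewrite intr_eq0; lia.
by move: h0; rewrite /h mulmxDl !mxE; lra.
Qed.

Lemma iter_near_linear_shift j (k x : 'rV[R]_n) : (forall i, k 0 i \is a Num.int) ->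
  iter j F (x + k) = iter j F x + iter j (mulmxr AR) k.
Proof.
move=> kint; elim: j => [//|j IH] /=; rewrite IH near_linear_shift//.
by elim: j {IH} => [//|j IH]; exact: int_mulmx.
Qed.

End torus_linear.

(** * Integration on the torus *)

Definition row_of_tuple (R : realType) (n : nat)
    (t : n.-tuple (measurableTypeR R)) : 'rV[R]_n := \row_(i < n) (tnth t i : R).

(* G is the pointwise limit of its composites with the rounding maps, which
   take countably many values. *)
Lemma measurable_continuous_row (R : realType) (n : nat) (G : 'rV[R]_n -> R) :
  continuous G -> measurable_fun setT (G \o @row_of_tuple R n).
Proof.
move=> Gc.
pose m1 (m : nat) : R := m.+1%:R.
pose z (m : nat) (t : n.-tuple (measurableTypeR R)) : n.-tuple int :=
  [tuple Num.floor (m1 m * tnth t i) | i < n].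
pose r (m : nat) (k : n.-tuple int) : 'rV[R]_n :=
  \row_(i < n) ((tnth k i)%:~R / m1 m).
apply: (@measurable_fun_cvg _ _ _ _ (fun m t => G (r m (z m t)))) => [m|t _].
  move=> _ B mB; rewrite setTI.
  rewrite (_ : _ @^-1` B = \bigcup_k ([set t | z m t = k] `&`
      [set t | B (G (r m k))])); last first.
    apply/seteqP; split => [t Bt|t [k _ [/= <-]]//].
    by exists (z m t).
  apply: countable_bigcupT_measurable => [//|k].
  have [Bk|nBk] := pselect (B (G (r m k))); last first.
    by rewrite (_ : [set t | B _] = set0) ?setI0//; apply/seteqP; split.
  rewrite (_ : [set t | B _] = setT) ?setIT; last by apply/seteqP; split.
  rewrite (_ : [set t | z m t = k] = \bigcap_(i in [set: 'I_n])
      (@tnth n R ^~ i) @^-1` [set x | Num.floor (m1 m * x) = tnth k i]).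
    apply: fin_bigcap_measurable => [|i _]; first exact: finite_finset.
    rewrite -[_ @^-1` _]setTI; apply: measurable_tnth => //.
    rewrite (_ : mkset _ = `[(tnth k i)%:~R / m1 m, ((tnth k i) + 1)%:~R / m1 m[%classic).
      exact: measurable_itv.
    apply/seteqP; split => x /=; rewrite in_itv/=.
      move=> <-; rewrite ler_pdivrMr ?ltr0n// ltr_pdivlMr ?ltr0n// mulrC.
      by rewrite Num.Theory.floor_le Num.Theory.floorD1_gt.
    rewrite ler_pdivrMr ?ltr0n// ltr_pdivlMr ?ltr0n// mulrC => kx.
    exact: Num.Theory.floor_def.
  apply/seteqP; split => [t <- i _ /=|t kt]; first by rewrite tnth_mktuple.
  by apply: eq_from_tnth => i; rewrite tnth_mktuple; exact: (kt i I).
suff rt : (fun m => r m (z m t)) @ \oo --> row_of_tuple t.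
  exact: (cvg_comp _ _ rt (Gc (row_of_tuple t))).
apply/(@cvgrPdist_le _ 'rV[R]_n) => e e0; near=> m.
rewrite /Num.Def.normr/= mx_normrE (bigmax_le _ (ltW e0))//= => -[i j] _ /=.
rewrite !mxE tnth_mktuple.
have m0 : 0 < m1 m by rewrite ltr0n.
have -> : tnth t j - (Num.floor (m1 m * tnth t j))%:~R / m1 m =
    (m1 m * tnth t j - (Num.floor (m1 m * tnth t j))%:~R) / m1 m.
  by rewrite mulrBl [m1 m * _]mulrC mulfK// gt_eqF.
rewrite normrM [`|(m1 m)^-1|]gtr0_norm ?invr_gt0// ler_pdivrMr//.
apply: (@le_trans _ _ 1).
  have := Num.Theory.floor_le (m1 m * tnth t j).
  have := Num.Theory.floorD1_gt (m1 m * tnth t j).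
  rewrite intrD ler_norml => H1 H2; apply/andP; split; lra.
rewrite -ler_pdivrMl// mulr1 (le_trans (ltW (archi_boundP _)))//.
  by rewrite invr_ge0 ltW.
rewrite ler_nat; apply: leqW; near: m; exact: nbhs_infty_ge.
Unshelve. all: by end_near. Qed.

Lemma measurable_torusP (R : realType) (n : nat) (B : set (torus R n)) :
  measurable B <-> measurable (@tuple_proj R n @^-1` B).
Proof. by rewrite -[@tuple_proj R n @^-1` B]setTI; split. Qed.

Lemma measurable_fun_torus (R : realType) (n : nat) (phi : torus R n -> R) :
  measurable_fun setT (phi \o @tuple_proj R n) -> measurable_fun setT phi.
Proof.
move=> mphi _ B mB; rewrite setTI; apply/measurable_torusP.
by have := mphi measurableT B mB; rewrite setTI.
Qed.

(** Measurability is tested on R^n, where f is represented by the coordinates of a continuous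
    lift. *)
Lemma measurable_lift (R : realType) (n : nat) (f : torus R n -> torus R n) F :
  C1_lift f F -> measurable_fun setT f.
Proof.
move=> lF _ B mB; rewrite setTI; apply/measurable_torusP.
pose Ft (t : n.-tuple (measurableTypeR R)) : n.-tuple (measurableTypeR R) :=
  [tuple F (row_of_tuple t) 0 i | i < n].
have mFt : measurable_fun setT Ft.
  apply/measurable_fun_tnthP => i.
  rewrite (_ : _ \o Ft = (fun x => F x 0 i) \o @row_of_tuple R n).
    apply: measurable_continuous_row => x.
    exact: (@continuous_entry R _ 1 n F x 0 i (@lift_continuous _ _ _ _ lF x)).
  by apply/funext => t; rewrite /= tnth_mktuple.
have := mFt measurableT _ ((measurable_torusP _).1 mB); rewrite setTI.
congr measurable; apply/seteqP.
have E t : tuple_proj (Ft t) = f (tuple_proj t).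
  rewrite /tuple_proj -(lift_proj lF); congr (proj _).
  by apply/rowP => i; rewrite mxE tnth_mktuple.
by split=> t /=; rewrite E.
Qed.

(** * Integration along coordinate lines and the mean of a directional derivative *)

Definition set_coord (T : Type) (n : nat) (t : n.-tuple T) (i : 'I_n) (s : T) :
  n.-tuple T := [tuple if j == i then s else tnth t j | j < n].

Lemma set_coord_cons0 (R : realType) (n : nat) (s u : R)
    (t : n.-tuple (measurableTypeR R)) :
  set_coord (cons_pair (s, t)) ord0 u = cons_pair (u, t).
Proof.
apply: eq_from_tnth => k; rewrite tnth_mktuple.
by case: (unliftP ord0 k) => [j|] ->; rewrite ?eqxx ?tnthS.
Qed.

Lemma set_coord_consS (R : realType) (n : nat) (s u : R)
    (t : n.-tuple (measurableTypeR R)) (j : 'I_n) :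
  set_coord (cons_pair (s, t)) (lift ord0 j) u = cons_pair (s, set_coord t j u).
Proof.
apply: eq_from_tnth => k; rewrite tnth_mktuple.
case: (unliftP ord0 k) => [l|] ->; last by rewrite (negPf (neq_lift _ _)) tnth0.
by rewrite (inj_eq lift_inj) !tnthS tnth_mktuple.
Qed.

(** Tonelli with coordinate i integrated innermost. The cube measure is built one coordinate at a
    time: i is either the head, or a coordinate of the tail handled by induction. *)
Lemma cube_integral_coord (R : realType) (n : nat)
    (h : n.-tuple (measurableTypeR R) -> R) (i : 'I_n) (v : R) :
  measurable_fun setT h -> (forall t, 0 <= h t) ->
  (forall t, \int[lebesgue_measure]_(s in `[0%R, 1%R]) (h (set_coord t i s))%:E = v%:E)%E ->
  (\int[cube_measure R n]_t (h t)%:E = v%:E)%E.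
Proof.
elim: n h i v => [h []//|n IH] h i v mh h0 hv.
have mhE : measurable_fun setT (EFin \o h) by exact/measurable_EFinP.
have mhc : measurable_fun setT ((EFin \o h) \o @cons_pair R n).
  exact: (measurableT_comp mhE (@measurable_cons_pair R n)).
have hc0 x : (0 <= ((EFin \o h) \o @cons_pair R n) x)%E by rewrite lee_fin.
rewrite /= ge0_integral_distribution//.
have mhs s : measurable_fun setT (fun t => h (cons_pair (s, t))).
  exact: (measurableT_comp mh (measurableT_comp (@measurable_cons_pair R n)
    (pair1_measurable s))).
have int_cst d (T : measurableType d) (P : probability T R) :
    (\int[P]_x v%:E = v%:E)%E.
  by rewrite integral_cst// [X in (_ * X)%E]probability_setT mule1.
have [j ij|i0] := unliftP ord0 i.
  rewrite fubini_tonelli1// /fubini_F -[RHS](int_cst _ _ (uniform_prob (@ltr01 R))).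
  apply: eq_integral => s _; apply: (IH (fun t => h (cons_pair (s, t))) j) => // t.
  rewrite -[RHS](hv (cons_pair (s, t))) ij.
  by under [RHS]eq_integral do rewrite set_coord_consS.
rewrite fubini_tonelli2// /fubini_G -[RHS](int_cst _ _ (cube_measure R n)).
apply: eq_integral => t _; rewrite integral_uniform//.
- rewrite subr0 invr1 mul1e -[RHS](hv (cons_pair (0, t))) i0.
  by under [RHS]eq_integral do rewrite set_coord_cons0.
- apply/measurable_EFinP.
  exact: (measurableT_comp mh (measurableT_comp (@measurable_cons_pair R n)
    (pair2_measurable t))).
Qed.

Section directional_average.
Variables (R : realType) (n : nat) (G : 'rV[R]_n -> 'rV[R]_n) (c : 'cV[R]_n).
Hypothesis GC1 : C1_on setT G.

Let g (x : 'rV[R]_n) : R := (G x *m c) 0 0.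
Let dg (v x : 'rV[R]_n) : R := (v *m jacobian G x *m c) 0 0.

Let derive_g v x : derivable g x v /\ 'D_v g x = dg v x.
Proof.
have dG : differentiable G x := (GC1 I).1.
have dc : differentiable (mulmxr c : 'rV[R]_n -> 'rV[R]_1) (G x).
  exact: differentiable_mulmxr.
have dGc := differentiable_comp dG dc.
have dv : derivable (mulmxr c \o G) x v by exact: diff_derivable.
split; first by have := (derivable_mxP _ _ _).1 dv 0 0.
have DE : 'D_v (mulmxr c \o G) x = v *m jacobian G x *m c.
  transitivity ('d (mulmxr c \o G) x v); first exact: deriveE.
  transitivity ('d (mulmxr c) (G x) ('d G x v)).
    exact: (congr1 (@^~ v) (diff_comp dG dc)).
  have cc : continuous (mulmxr c : 'rV[R]_n -> 'rV[R]_1).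
    by move=> y; apply: differentiable_continuous; exact: differentiable_mulmxr.
  transitivity (mulmxr c ('d G x v)).
    exact: (congr1 (@^~ ('d G x v)) (diff_lin (G x) cc)).
  rewrite /=; congr (_ *m c); transitivity ('D_v G x); first exact/esym/deriveE.
  exact/esym/mulmx_jacobian.
have := congr1 (fun M : 'rV[R]_1 => M 0 0) (derive_mx dv).
by rewrite DE [RHS]mxE => H; exact: esym H.
Qed.

Let is_derive_line (v x : 'rV[R]_n) (s : R) :
  is_derive s 1 (fun s => g (x + s *: v)) (dg v (x + s *: v)).
Proof.
have [dv DE] := derive_g v (x + s *: v).
have E : (fun h : R => h^-1 *: (((fun s => g (x + s *: v)) \o shift s) (h *: 1) -
      g (x + s *: v))) =
    (fun h : R => h^-1 *: ((g \o shift (x + s *: v)) (h *: v) - g (x + s *: v))).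
  apply/funext => h /=; congr (_ *: (g _ - _)).
  have -> : h *: 1 = h by exact: mulr1.
  by rewrite scalerDl addrCA.
split; first by rewrite /derivable E.
by rewrite -DE /derive E.
Qed.

Let continuous_dg v : continuous (dg v).
Proof.
move=> x; have h1 : {for x, continuous (jacobian G)} := (GC1 I).2.
have h2 : {for x, continuous (fun y => v *m jacobian G y)}.
  by apply: (continuous_mulmx _ h1); exact: cst_continuous.
have h3 : {for x, continuous (fun y => v *m jacobian G y *m c)}.
  by apply: (continuous_mulmx h2); exact: cst_continuous.
exact: (@continuous_entry R _ 1 1 _ x 0 0 h3).
Qed.

Let line_continuous (v x : 'rV[R]_n) : continuous (fun s : R => x + s *: v).
Proof.
move=> s; apply: (@cvgD _ _ _ (nbhs s)); first exact: cvg_cst.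
by apply: cvgZl; exact: cvg_id.
Qed.

(** The fundamental theorem of calculus along a segment; the added constant [M] will be chosen to
    make the integrand nonnegative. *)
Let integral_segment (v x : 'rV[R]_n) (M : R) :
  (\int[lebesgue_measure]_(s in `[0%R, 1%R]) (dg v (x + s *: v) + M)%:E =
   (g (x + v) - g x + M)%:E)%E.
Proof.
have dU (s : R) : is_derive s (1 : R) (fun s : R => g (x + s *: v) + M * s)
    (dg v (x + s *: v) + M).
  have := is_deriveD (is_derive_line v x s) (is_deriveZ M (is_derive_id s (1 : R))).
  by rewrite [M *: 1]mulr1.
have Uc (s : R) : {for s, continuous (fun s : R => g (x + s *: v) + M * s)}.
  apply: differentiable_continuous; apply/derivable1_diffP.
  exact: (@ex_derive _ _ _ _ _ _ _ (dU s)).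
rewrite (@continuous_FTC2 R (fun s => dg v (x + s *: v) + M)
  (fun s => g (x + s *: v) + M * s))//.
- by rewrite -EFinB scale0r addr0 scale1r mulr0 addr0 mulr1 addrAC.
- apply: continuous_subspaceT => s; apply: cvgD; last exact: cvg_cst.
  exact: (cvg_comp _ _ (@line_continuous v x s) (@continuous_dg v _)).
- split.
  + by move=> s _; exact: (@ex_derive _ _ _ _ _ _ _ (dU s)).
  + exact: cvg_at_right_filter (Uc 0).
  + exact: cvg_at_left_filter (Uc 1).
- by move=> s _; rewrite derive1E; exact: (@derive_val _ _ _ _ _ _ _ (dU s)).
Qed.

Variable M : R.
Hypothesis dgM : forall v x, `|dg v x| <= M * `|v|.
Variable shift_c : 'rV[R]_n -> R.
Hypothesis g_shift : forall i x, g (x + delta_mx 0 i) - g x = shift_c (delta_mx 0 i).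

Let measurable_dg v : measurable_fun setT (dg v \o @row_of_tuple R n).
Proof. exact: measurable_continuous_row (@continuous_dg v). Qed.

Let integrable_dg v : (cube_measure R n).-integrable setT
  (EFin \o (dg v \o @row_of_tuple R n)).
Proof.
apply: measurable_bounded_integrable => //.
  by rewrite (le_lt_trans (probability_le1 _ _))// ltry.
exists (M * `|v|); split; first exact: num_real.
by move=> x Mx t _ /=; rewrite (le_trans (dgM _ _))// ltW.
Qed.

Let integral_partial i :
  (\int[cube_measure R n]_t (dg (delta_mx 0 i) (row_of_tuple t))%:E =
   (shift_c (delta_mx 0 i))%:E)%E.
Proof.
set v := delta_mx 0 i.
(* Adding K makes the integrand nonnegative, as [integral_uniform] requires. *)
pose K := M * `|v|.
have rowE t s : row_of_tuple (set_coord t i s) =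
    row_of_tuple (set_coord t i (0 : R)) + s *: v.
  apply/rowP => j; rewrite !mxE !tnth_mktuple !eqxx /=.
  by case: eqP => _; rewrite ?mulr1 ?add0r// mulr0 addr0.
have H : (\int[cube_measure R n]_t (dg v (row_of_tuple t) + K)%:E =
    (shift_c v + K)%:E)%E.
  apply: (@cube_integral_coord R n (fun t => dg v (row_of_tuple t) + K) i).
  - by apply: measurable_funD => //; exact: measurable_dg.
  - by move=> t; have := dgM v (row_of_tuple t); rewrite ler_norml -/K => /andP[]; lra.
  - move=> t; under eq_integral do rewrite rowE.
    by rewrite integral_segment g_shift.
have : (\int[cube_measure R n]_t ((dg v (row_of_tuple t))%:E + K%:E) =
    (shift_c v + K)%:E)%E by rewrite -H; apply: eq_integral => t _; rewrite EFinD.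
rewrite integralD//=; first last.
- by apply: finite_measure_integrable_cst.
- exact: integrable_dg.
rewrite integral_cst// [X in (_ * X)%E]probability_setT mule1.
move/(congr1 (fun z => z - K%:E)%E).
by rewrite addeK// -EFinB addrK.
Qed.

(** The sides of the cube close up to circles of the torus only in coordinate directions, so v is
    expanded in the standard basis. *)
Lemma integral_directional (v : 'rV[R]_n) :
  (\int[cube_measure R n]_t ((v *m jacobian G (row_of_tuple t) *m c) 0 0)%:E =
   (\sum_i v 0 i * shift_c (delta_mx 0 i))%:E)%E.
Proof.
have E t : (dg v (row_of_tuple t))%:E =
    (\sum_i ((v 0 i)%:E * (dg (delta_mx 0 i) (row_of_tuple t))%:E))%E.
  rewrite /dg {1}(row_sum_delta v) !mulmx_suml summxE sumEFin; congr (_%:E).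
  by apply: eq_bigr => i _; rewrite -!scalemxAl mxE.
under eq_integral do rewrite E.
rewrite integral_sum//; last first.
  by move=> i; apply: integrableZl => //; exact: integrable_dg.
rewrite -sumEFin; apply: eq_bigr => i _.
rewrite integralZl//; last exact: integrable_dg.
by rewrite integral_partial.
Qed.
End directional_average.

(** Markov bounds the measure of b_k >= (r rho)^k by rho^-k. A limit above ln r forces this event
    for all large k, for some rho among countably many exceeding 1, and an intersection of events
    whose measures tend to 0 is null. *)
Lemma ae_growth_rate_le d (T : measurableType d) (R : realType)
    (P : probability T R) (b : nat -> T -> R) (r : R) :
  0 < r -> (forall k, measurable_fun setT (b k)) -> (forall k x, 0 < b k x) ->
  (forall k, \int[P]_x (b k x)%:E <= (r ^+ k)%:E)%E ->
  {ae P, forall x, forall l : R,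
    (fun k => k%:R^-1 * ln (b k x)) @ \oo --> l -> l <= ln r}.
Proof.
move=> r0 mb b0 ib.
pose rho (i : nat) : R := expR (i.+1%:R^-1).
have rho1 i : 1 < rho i by rewrite expR_gt1 invr_gt0.
have rho0 i : 0 < rho i by rewrite expR_gt0.
pose A i k : set T := [set x | (r * rho i) ^+ k <= b k x].
have mA i k : measurable (A i k).
  rewrite (_ : A i k = b k @^-1` `[(r * rho i) ^+ k, +oo[%classic); last first.
    by apply/seteqP; split => x /=; rewrite in_itv/= andbT.
  by rewrite -[_ @^-1` _]setTI; apply: mb => //; exact: measurable_itv.
have PA i k : (P (A i k) <= ((rho i)^-1 ^+ k)%:E)%E.
  have rk : 0 < (r * rho i) ^+ k by rewrite exprn_gt0// mulr_gt0.
  have mI : measurable_fun setT (EFin \o (\1_(A i k) : T -> R)).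
    by apply/measurable_EFinP; exact: measurable_indic.
  have le_int : (\int[P]_x (((r * rho i) ^+ k)%:E * (\1_(A i k) x)%:E) <=
      \int[P]_x (b k x)%:E)%E.
    apply: ge0_le_integral => //.
    - by move=> x _; rewrite mule_ge0// lee_fin ?(ltW rk)// indicE.
    - exact: measurable_funeM.
    - exact/measurable_EFinP.
    - move=> x _; rewrite -EFinM lee_fin indicE.
      have [Ax|nAx] := pselect (A i k x); first by rewrite mem_set// mulr1.
      by rewrite memNset// mulr0 ltW.
  move: (le_trans le_int (ib k)).
  rewrite ge0_integralZl_EFin//; last exact: ltW.
  rewrite integral_indic// setIT muleC -lee_pdivlMr// => /le_trans; apply.
  by rewrite lee_fin exprMn invfM mulrA mulfV ?gt_eqF ?exprn_gt0// mul1r exprVn.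
have null i N : P.-negligible (\bigcap_(k in [set k | (N <= k)%N]) A i k).
  apply/negligibleP; first by apply: bigcap_measurableType => k _; exact: mA.
  apply/eqP; rewrite eq_le measure_ge0 andbT.
  have cvg0 : ((rho i)^-1 ^+ k)%:E @[k --> \oo] --> (0 : \bar R).
    apply: cvg_EFin; first exact: nearW.
    apply: cvg_expr; rewrite gtr0_norm ?invr_gt0// invf_lt1//.
  apply: (cvge_ge _ cvg0); near=> k; apply: le_trans (PA i k).
  rewrite le_measure ?inE//; first by apply: bigcap_measurableType => j _; exact: mA.
  by apply: bigcap_inf => /=; near: k; exact: nbhs_infty_ge.
have := negligible_bigcup (fun i => negligible_bigcup (null i)).
apply: negligibleS => x /= /existsNP[l /not_implyP[bl /negP]].
rewrite -ltNge => rl.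
have [i ri] : exists i : nat, ln r + i.+1%:R^-1 < l.
  have d0 : 0 < l - ln r by rewrite subr_gt0.
  have /archi_boundP : 0 <= (l - ln r)^-1 by rewrite invr_ge0 ltW.
  set m := Num.bound _ => Hm; exists m.
  rewrite addrC -ltrBrDr.
  rewrite -[ltRHS]invrK ltf_pV2 ?posrE ?ltr0n ?invr_gt0//.
  by rewrite (lt_trans Hm)// ltr_nat.
exists i => //.
have d0 : 0 < l - (ln r + i.+1%:R^-1) by rewrite subr_gt0.
move/cvgrPdist_lt: bl => /(_ _ d0)[N _ HN]; exists N.+1 => // k /= Nk.
have := HN k (ltnW Nk); rewrite /= => /(le_lt_trans (ler_norm _)).
rewrite ltrD2l ltrN2 /A /= => lb.
have k0 : 0 < k%:R :> R by rewrite ltr0n (leq_trans _ Nk).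
have : k%:R * (ln r + i.+1%:R^-1) < ln (b k x).
  by rewrite -ltr_pdivlMl.
move=> H; rewrite -[leRHS]lnK ?posrE//.
have -> : (r * rho i) ^+ k = expR (k%:R * (ln r + i.+1%:R^-1)).
  by rewrite expRM_natl expRD lnK ?posrE.
by rewrite ler_expR ltW.
Unshelve. all: by end_near. Qed.

(** * The theorem *)

Section expansion_average.
Variables (R : realType) (n : nat) (A : 'M[int]_n.+1) (e : 'rV[R]_n.+1)
  (c : 'cV[R]_n.+1) (mu : R).
Let AR : 'M[R]_n.+1 := map_mx intr A.
Hypotheses (ec : e *m c = 1%:M) (Ac : AR *m c = mu *: c).
Variables (f : torus R n.+1 -> torus R n.+1)
  (F : 'rV[R]_n.+1 -> 'rV[R]_n.+1) (d B : R).
Hypotheses (liftF : C1_lift f F) (d2 : d <= 2^-1)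
  (f_near : forall p, exists x y : 'rV[R]_n.+1,
    [/\ proj x = f p, proj y = torus_linear A p & `|x - y| < d])
  (tderivB : forall p, `|tderiv f p| <= B).

Let D k p := tderiv (iter k f) p.

Let C1f : C1_map f. Proof. by exists F. Qed.

Let expansion_tuple k (t : n.+1.-tuple (measurableTypeR R)) :
  expansion e c mu D k (tuple_proj t) =
  Num.sg mu ^+ k * (e *m jacobian (iter k F) (row_of_tuple t) *m c) 0 0.
Proof.
have E := tderivE (C1_lift_iter k liftF) (row_of_tuple t).
exact: (congr1 (fun M : 'M[R]_n.+1 => Num.sg mu ^+ k * (e *m M *m c) 0 0) E).
Qed.

Lemma measurable_expansion k :
  measurable_fun setT (expansion e c mu D k).
Proof.
apply: measurable_fun_torus.
rewrite (_ : _ \o _ = (fun x => Num.sg mu ^+ k *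
    (e *m jacobian (iter k F) x *m c) 0 0) \o @row_of_tuple R n.+1); last first.
  by apply/funext => t; exact: expansion_tuple.
apply: measurable_continuous_row => x; apply: (@continuousM _ _ (fun=> Num.sg mu ^+ k) _ x).
  exact: cst_continuous.
have h1 : {for x, continuous (jacobian (iter k F))}.
  exact: (@lift_jacobian_continuous _ _ _ _ (C1_lift_iter k liftF) x).
have h2 : {for x, continuous (fun y => e *m jacobian (iter k F) y)}.
  by apply: (continuous_mulmx _ h1); exact: cst_continuous.
have h3 : {for x, continuous (fun y => e *m jacobian (iter k F) y *m c)}.
  by apply: (continuous_mulmx h2); exact: cst_continuous.
exact: (@continuous_entry R _ 1 1 _ x 0 0 h3).
Qed.

Let tderiv_iter_bounded k : exists Bk : R, forall p, `|D k p| <= Bk.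
Proof.
elim: k => [|k [Bk IH]].
  by exists `|1%:M : 'M[R]_n.+1| => p; rewrite /D tderiv_id.
exists (n.+1%:R * Bk * B) => p.
rewrite (_ : D k.+1 p = D k p *m tderiv f (iter k f p)).
  by apply: le_trans (mx_norm_mul _ _) _; rewrite ler_pM// ler_wpM2l.
by rewrite /D -[k.+1]addn1 tderiv_iterD.
Qed.

Let iter_linear_c k (v : 'rV[R]_n.+1) :
  iter k (mulmxr AR) v *m c = mu ^+ k *: (v *m c).
Proof.
elim: k => [|k IH]; first by rewrite expr0 scale1r.
by rewrite iterS /= -mulmxA Ac -scalemxAr IH scalerA exprS.
Qed.

Lemma integral_expansion k : (forall p, 0 <= expansion e c mu D k p) ->
  (\int[torus_measure R n.+1]_p (expansion e c mu D k p)%:E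
   = (`|mu| ^+ k)%:E)%E.
Proof.
have [Bk HBk] := tderiv_iter_bounded k.
have liftk := C1_lift_iter k liftF.
have jacB x : `|jacobian (iter k F) x| <= Bk.
  by rewrite -(tderivE liftk); exact: HBk.
have pi_le (v : 'rV[R]_n.+1) : `|(v *m c) 0 0| <= n.+1%:R * `|v| * `|c|.
  by apply: le_trans (le_mx_norm_entry _ _ _) _; exact: mx_norm_mul.
have dgM (v x : 'rV[R]_n.+1) : `|(v *m jacobian (iter k F) x *m c) 0 0| <=
    n.+1%:R * n.+1%:R * Bk * `|c| * `|v|.
  apply: le_trans (pi_le _) _.
  have := le_trans (mx_norm_mul v (jacobian (iter k F) x))
    (ler_wpM2l _ (jacB x)); rewrite mulr_ge0// => /(_ isT) H.
  have := ler_wpM2r (normr_ge0 c) (ler_wpM2l (ler0n R n.+1) H).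
  by move=> /le_trans; apply; rewrite le_eqVlt; apply/orP; left; apply/eqP; ring.
pose shift_c (v : 'rV[R]_n.+1) : R := mu ^+ k * (v *m c) 0 0.
have g_shift (i : 'I_n.+1) (x : 'rV[R]_n.+1) :
    (iter k F (x + delta_mx 0 i) *m c) 0 0 - (iter k F x *m c) 0 0 =
    shift_c (delta_mx 0 i).
  rewrite (iter_near_linear_shift liftF d2 f_near) => [|j]; last first.
    by rewrite mxE; case: (_ && _).
  by rewrite mulmxDl iter_linear_c /shift_c !mxE; ring.
have avg := integral_directional liftk.2 dgM g_shift (Num.sg mu ^+ k *: e).
move=> E0; rewrite /torus_measure ge0_integral_distribution; first last.
- by move=> p; rewrite lee_fin.
- by apply/measurable_EFinP; exact: measurable_expansion.
transitivity (\int[cube_measure R n.+1]_t ((Num.sg mu ^+ k *: e *m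
    jacobian (iter k F) (row_of_tuple t) *m c) 0 0)%:E)%E.
  apply: eq_integral => t _ /=; rewrite expansion_tuple; congr (_%:E).
  by rewrite -!scalemxAl [RHS]mxE.
rewrite avg; congr (_%:E).
(* The shifts of pi F^k along basis vectors are mu^k pi(delta_i); weighted by the coordinates of e
   they add up to mu^k pi(e) = mu^k, and the sign factor turns this into |mu|^k. *)
have -> : \sum_(i < n.+1) (Num.sg mu ^+ k *: e) 0 i * shift_c (delta_mx 0 i) =
    Num.sg mu ^+ k * mu ^+ k *
    (\sum_(i < n.+1) e 0 i * ((delta_mx 0 i : 'rV[R]_n.+1) *m c) 0 0).
  by rewrite mulr_sumr; apply: eq_bigr => i _; rewrite mxE /shift_c; ring.
have -> : \sum_(i < n.+1) e 0 i * ((delta_mx 0 i : 'rV[R]_n.+1) *m c) 0 0 = (e *m c) 0 0.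
  rewrite [in RHS](row_sum_delta e) mulmx_suml summxE.
  by apply: eq_bigr => i _; rewrite -scalemxAl [RHS]mxE.
by rewrite ec mxE eqxx mulr1 -exprMn -normrEsg.
Qed.
End expansion_average.

Lemma ltr_dist_trans (R : numDomainType) (V : normedZmodType R) (x y z : V)
    (d e : R) : `|x - z| < d -> `|x - y| < e -> `|y - z| < d + e.
Proof.
move=> xz xy; have -> : y - z = (x - z) - (x - y) by rewrite opprB [RHS]addrC addrA subrK.
by rewrite (le_lt_trans (ler_normB _ _))// ltrD.
Qed.

(** The factors [k1] and [k2] become additive constants under ln, and dividing by k removes them in
    the limit. *)
Lemma restr_norm_cvg (R : realType) (r b : nat -> R) (k1 k2 l : R) :
  0 < k1 -> (forall k, 0 < b k) ->
  (forall k, k1 * b k <= r k <= k2 * b k) ->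
  (fun k => k%:R^-1 * ln (b k)) @ \oo --> l ->
  (fun k => k%:R^-1 * ln (r k)) @ \oo --> l.
Proof.
move=> k10 b0 rb bl.
have k20 : 0 < k2.
  have /andP[lo hi] := rb 0%N.
  by have := lt_le_trans (mulr_gt0 k10 (b0 0%N)) (le_trans lo hi); rewrite pmulr_lgt0.
have inv0 (K : R) : (fun k => k%:R^-1 * K) @ \oo --> (0 : R).
  rewrite -(mul0r K); apply: cvgMl.
  by rewrite -cvg_shiftS; exact: cvg_harmonic.
have cv (K : R) : (fun k => k%:R^-1 * K + k%:R^-1 * ln (b k)) @ \oo --> l.
  by rewrite -[l]add0r; apply: cvgD.
apply: (@squeeze_cvgr _ _ _ _ (fun k => k%:R^-1 * ln k1 + k%:R^-1 * ln (b k))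
  (fun k => k%:R^-1 * ln k2 + k%:R^-1 * ln (b k))) => //.
apply: nearW => k; have /andP[lo hi] := rb k.
have r0 : 0 < r k by rewrite (lt_le_trans _ lo)// mulr_gt0.
rewrite -!mulrDr -!lnM ?posrE// !ler_wpM2l ?invr_ge0//.
  by rewrite ler_ln ?posrE// mulr_gt0.
by rewrite ler_ln ?posrE// mulr_gt0.
Qed.

Theorem theorem1p5 (R : realType) (n : nat) (n_ge2 : (2 <= n)%N)
    (A : 'M[int]_n) (hA : linear_anosov R A)
    (Eu : 'M[R]_n) (hEu : is_linear_unstable_subspace A Eu)
    (dimEu : \rank Eu = 1%N)
    (mu : R) (hmu : Eu *m map_mx intr A = mu *: Eu) :
  exists U : set (torus R n -> torus R n),
    [/\ C1_open U, U (torus_linear A) &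
      forall f : torus R n -> torus R n, U f ->
        anosov f -> conservative f ->
        forall alpha : R, 0 < alpha -> C1_alpha alpha f ->
        {ae torus_measure R n, forall p : torus R n,
          exists2 l : R, is_unstable_exponent f p l & l <= ln `|mu|}].
Proof.
case: n n_ge2 A hA Eu hEu dimEu hmu => [//|n] _ A hA Eu hEu dimEu hmu.
have [e [c [eA ec Ac mu1 decay]]] := hyperbolic_data hA hEu dimEu hmu.
have [T [theta [C [/andP[th0 th1] C0 [TD TZ] [Te TA] normT]]]] :=
  adapted_seminorm eA ec Ac decay.
set AR : 'M[R]_n.+1 := map_mx intr A in hmu eA Ac TA *.
have T_le v : T v <= C * `|v| by case: (normT v).
have pi_le (v : 'rV[R]_n.+1) : `|(v *m c) 0 0| <= C * `|v| by case: (normT v).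
have norm_le (v : 'rV[R]_n.+1) : `|v| <= C * (`|(v *m c) 0 0| + T v).
  by case: (normT v).
have [d0 [d0_gt0 d0_half [kappa [kappa0 kappa_mu kappa_th near_bound]]]] :
    exists d0 : R, [/\ 0 < d0, d0 <= 2^-1 & exists kappa : R,
      [/\ 0 <= kappa, 2 * kappa <= `|mu| - 1, 4 * kappa <= 1 - theta &
        forall (J : 'M[R]_n.+1) (v : 'rV[R]_n.+1), `|J - AR| <= d0 ->
          C * `|v *m (J - AR)| <= kappa * (`|(v *m c) 0 0| + T v)]].
  have N0 : 0 < C * n.+1%:R * C by rewrite !mulr_gt0.
  (* [q] bounds kappa as both cone conditions demand. In kappa = C n C d0, with n the dimension, the
     factors come from T and pi against the norm, the matrix product, and the norm against |pi| +
     T. *)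
  pose q : R := Num.min ((`|mu| - 1) / 2) ((1 - theta) / 4).
  have q0 : 0 < q by rewrite lt_min !divr_gt0// subr_gt0.
  pose d0 : R := Num.min 2^-1 (q / (C * n.+1%:R * C)).
  have d00 : 0 < d0 by rewrite lt_min divr_gt0// invr_gt0 ltr0n.
  have kq : C * n.+1%:R * C * d0 <= q.
    by rewrite mulrC -ler_pdivlMr// ge_min lexx orbT.
  exists d0; split => //; first by rewrite ge_min lexx.
  exists (C * n.+1%:R * C * d0); split.
  - by rewrite mulr_ge0// ltW.
  - by rewrite mulrC -ler_pdivlMr// (le_trans kq)// ge_min lexx.
  - by rewrite mulrC -ler_pdivlMr// (le_trans kq)// ge_min lexx orbT.
  move=> J v Jd; apply: (@le_trans _ _ (C * (n.+1%:R * (C * (`|(v *m c) 0 0| + T v)) * d0))).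
    rewrite ler_wpM2l ?(ltW C0)// (le_trans (mx_norm_mul _ _))//.
    by rewrite ler_pM// ?mulr_ge0// ler_wpM2l.
  by rewrite le_eqVlt; apply/orP; left; apply/eqP; ring.
pose near_A (J : 'M[R]_n.+1) := `|J - AR| <= d0.
have near_pi J v : near_A J ->
    `|(v *m (J - AR) *m c) 0 0| <= kappa * (`|(v *m c) 0 0| + T v).
  by move=> /(near_bound J v); exact: le_trans (pi_le _).
have near_T J v : near_A J -> T (v *m (J - AR)) <= kappa * (`|(v *m c) 0 0| + T v).
  by move=> /(near_bound J v); exact: le_trans (T_le _).
pose close d (f : torus R n.+1 -> torus R n.+1) := forall p,
  (exists x y : 'rV[R]_n.+1,
    [/\ proj x = f p, proj y = torus_linear A p & `|x - y| < d]) /\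
  `|tderiv f p - AR| < d.
(* The radius d < d0 is common to all p, which leaves room (d0 - d) / 2 for a perturbation and makes
   the set open. *)
exists [set f | C1_map f /\ exists2 d, d < d0 & close d f]; split.
- move=> f [C1f [d dd0 close_f]]; split=> //.
  exists ((d0 - d) / 2) => [|g C1g fg]; first by rewrite divr_gt0// subr_gt0.
  split=> //; exists (d + (d0 - d) / 2); first by lra.
  move=> p; have [[x [y [xf yA xy]]] Df] := close_f p.
  have [[x' [y' [x'f y'g /(le_lt_trans (mx_norm_le_enorm _)) xy']]] Dg] := fg p.
  split.
    (* Both x and x' represent f p, so y' is moved by the integer vector x - x' to a representative
       of g p close to x. *)
    exists (y' + (x - x')), y; split=> //.
      rewrite -y'g; apply/proj_eqP => i; rewrite [y' + _]addrC addrK.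
      by apply/(proj_eqP _ _).1; rewrite xf x'f.
    have -> : y' + (x - x') - y = (x - y) - (x' - y').
      by apply/rowP => i; rewrite !mxE; ring.
    by rewrite (le_lt_trans (ler_normB _ _))// ltrD.
  exact: ltr_dist_trans Df Dg.
- split; first by exists (mulmxr AR); exact: C1_lift_torus_linear.
  exists (d0 / 2) => [|p]; first by lra.
  have d02 : 0 < d0 / 2 by rewrite divr_gt0.
  split; last by rewrite tderiv_torus_linear subrr normr0.
  by exists (repr (torus_linear A p)), (repr (torus_linear A p));
    rewrite !proj_repr subrr normr0.
move=> f [C1f [d dd0 close_f]] _ cons_f alpha _ _.
have [F lF] := C1f.
pose D k p := tderiv (iter k f) p.
have D0 p : D 0%N p = 1%:M := tderiv_id p.
have D1 p : near_A (D 1%N p) by rewrite /near_A ltW// (lt_trans (close_f p).2).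
have DD k l p : D (k + l)%N p = D k p *m D l (iter k f p) by exact: tderiv_iterD.
have [K [KD K1]] := ln_expansion_near_additive ec Ac TD TZ Te TA kappa0 th0 th1
  mu1 kappa_mu kappa_th near_pi near_T D0 D1 DD.
have b1 := expansion_ge1 ec Ac TD TZ Te TA kappa0 th0 th1
  mu1 kappa_mu kappa_th near_pi near_T D0 D1 DD.
have b0 k p : 0 < expansion e c mu D k p by exact: lt_le_trans (b1 k p).
have mb k : measurable_fun setT (expansion e c mu D k).
  exact: measurable_expansion lF k.
have ib k : (\int[torus_measure R n.+1]_p (expansion e c mu D k p)%:E <=
    (`|mu| ^+ k)%:E)%E.
  rewrite (@integral_expansion _ _ A e c mu ec Ac f F d (`|AR| + d0) lF)//.
  - exact: le_trans (ltW dd0) d0_half.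
  - by move=> p; exact: (close_f p).1.
  - move=> p; rewrite -[tderiv f p](subrK AR) addrC (le_trans (ler_normD _ _))//.
    by rewrite lerD2l; exact: D1.
  - by move=> p; exact: ltW.
have mc k : measurable_fun setT (fun p => ln (expansion e c mu D k p)).
  exact: (measurableT_comp (@measurable_ln R) (mb k)).
have lim_ae := near_additive_cvg (measurable_lift lF) cons_f mc KD K1.
have mu0 : 0 < `|mu| by exact: lt_trans mu1.
have rate_ae := ae_growth_rate_le mu0 mb b0 ib.
apply: filterS2 lim_ae rate_ae => p /cvg_ex[l cl] rate.
exists l; last exact: rate.
(* The null set and [l] were fixed before the orbit; the comparison constants may depend on the
   orbit, but not the limit. *)
move=> x E xf xp [C' [lam [Es [Eu' [C'0 lam1 [sumE invE expE conE] EE]]]]].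
rewrite -xp in cl *.
have [k1 [k2 [k10 Hk]]] := restr_norm_expansion ec Ac TD TZ Te TA kappa0 th0 th1
  mu1 kappa_mu kappa_th near_pi near_T D0 D1 DD C0 T_le pi_le norm_le C'0 lam1
  xf (sumE 0).1 (fun i => (invE i).2) expE conE EE.
exact: restr_norm_cvg k10 (fun k => b0 k (x 0)) Hk cl.
Qed.
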